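(* Let $\alpha,\gamma\in\mathbb{Z}$ with $\gamma>0$ and $\alpha^\gamma\ne1$. Let $\ell(W)$ be the derived length of the group $W=\langle X,Y,Z\mid X^Z=X^\alpha,\ {}^ZY=Y^\alpha,\ Z^\gamma=[X,Y]\rangle$. Then $\ell(W)=2$ if $\alpha=-1$ and $\gamma$ is odd, or $\alpha=3$ and $\gamma=1$; else $\ell(W)=3$.
   Context: Conventions: $x^y=y^{-1}xy$, ${}^yx=yxy^{-1}$, $[x,y]=x^{-1}y^{-1}xy$. The group $W$ is finite and solvable.
   Formalization: The cases α = 0 and (α,γ) = (2,1) are excluded, because the claim ℓ(W) = 3 is false there: for α = 0 the group W is cyclic of order γ, and for (2,1) it is perfect and solvable, hence trivial. *)

(* Defs.v *)
From HB Require Import structures.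
From mathcomp Require Import all_boot all_order all_algebra.
From mathcomp Require Import all_fingroup all_solvable.

Set Implicit Arguments.
Unset Strict Implicit.
Unset Printing Implicit Defensive.

(* Integer exponents in presentations: the entry group_presentation only has  *)
(* natural exponents. The notation follows x *~ a of ssrint.                  *)
Definition pres_expz (t : Presentation.term) (a : int) : Presentation.term :=
  match a with
  | Posz n => Presentation.Exp t n
  | Negz n => Presentation.Inv (Presentation.Exp t n.+1)
  end.

Notation "x ^~ a" := (pres_expz x a)
  (in custom group_presentation at level 29, a constr at level 28).

(* Meaningful for solvable groups, see derived_lengthP; same encoding as      *)
(* nil_class. For a non-solvable A the value is the dummy #|A|.               *)
Definition derived_length (gT : finGroupType) (A : {set gT}) : nat :=
  index 1%g (mkseq (fun n => A^`(n)%g) #|A|).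

Lemma derived_lengthP (gT : finGroupType) (G : {group gT}) (n : nat) :
  solvable G -> (G^`(n)%g == 1%g) = (derived_length G <= n).
Proof.
move=> solG.
have step m : G^`(m)%g != 1%g -> #|G^`(m.+1)%g| < #|G^`(m)%g|.
  move=> ntGm; apply: proper_card.
  exact: (sol_der1_proper solG (der_sub m G) ntGm).
have card m : G^`(m)%g != 1%g -> #|G^`(m)%g| + m <= #|G|.
  elim: m => [|m IHm] ntGm; first by rewrite derg0 addn0.
  have ntGm' : G^`(m)%g != 1%g.
    apply: contraNneq ntGm => Gm1; rewrite -subG1 -Gm1.
    exact: der_subS.
  by rewrite addnS; apply: leq_trans (IHm ntGm'); rewrite ltn_add2r step.
have dec m p : m <= p -> G^`(m)%g == 1%g -> G^`(p)%g == 1%g.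
  move=> le_mp /eqP Gm1; rewrite -subG1 -Gm1 -(subnKC le_mp).
  by elim: (p - m) => [|k IHk]; rewrite ?addn0 // addnS (subset_trans (der_subS _ _)).
set s := mkseq (fun n => G^`(n)%g) #|G|.
have size_s : size s = #|G| by rewrite size_mkseq.
have in_s m : G^`(m)%g == 1%g -> m < #|G| -> derived_length G <= m.
  move=> /eqP Gm1 ltm; rewrite leqNgt; apply/negP => lt.
  by have := before_find 1%g lt; rewrite nth_mkseq //= Gm1 eqxx.
have s1 : 1%g \in s.
  have /(leq_trans _) lt: #|G|.-1 < #|G| by rewrite prednK ?cardG_gt0.
  apply/mapP; exists #|G|.-1; first by rewrite mem_iota lt.
  apply/esym/eqP/negPn/negP => nt; have := card _ nt.
  have : 1 < #|G^`(#|G|.-1)%g| by rewrite cardG_gt1.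
  by have := cardG_gt0 G; case: #|G| => // k _; case: #|_| => [|[|c]] //; rewrite !addSn !ltnS ltnNge leq_addl.
have lt_l : derived_length G < #|G| by rewrite -[X in _ < X]size_s index_mem.
have l1 : G^`(derived_length G)%g == 1%g.
  by have := nth_index 1%g s1; rewrite nth_mkseq // => ->.
apply/idP/idP => [Gn1 | /dec]; last by apply.
case: (ltnP n #|G|) => [/(in_s _ Gn1) // | le_n]; exact: leq_trans (ltnW lt_l) le_n.
Qed.

(* Main.v *)
Require Import Defs.
From HB Require Import structures.
From mathcomp Require Import all_boot all_order all_algebra.
From mathcomp Require Import all_fingroup all_solvable.
From mathcomp Require Import zify ring.
From Stdlib Require BinNat Nnat.

Set Implicit Arguments.
Unset Strict Implicit.
Unset Printing Implicit Defensive.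

(** Put m = alpha^gamma, n = m - 1, s = alpha - 1 and C = [X, Y] = Z^gamma.
    Conjugation by C raises X to the power m, and conjugation by its inverse
    does the same to Y, so that J = <X, Y> is a quotient of a group of
    Macdonald. The quotient W / J is cyclic, and W' lies in the group
    generated by C, X^s and Y^s.

    Upper bound. Let k = alpha^j. The conjugate of Y by X^k can be read off
    [X^k, Y] = C^k X^-e, where e = n \sum_(i < k) i m^i, and it can also be
    computed from X^k = Z^-j X Z^j. The comparison puts X^e in <Y>, so that X^e
    is central in J ([wamsley_commute]). The p-adic valuations of these
    exponents for k = alpha and k = alpha^2 then show that X^e and Y^e are
    central in J as soon as gcd(3, s) s n divides 2e ([central_exponent]).
    Modulo the centre of J, the group <C, X^s, Y^s> is therefore of class at
    most 2, its derived subgroup being contained in <X^(sn), Y^(sn), C^(s^2)>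
    ([collapsed_der1]). Those three elements commute in J itself, whence
    W''' = 1 ([wamsley_der3]). If alpha = -1 with gamma odd, or if alpha = 3
    and gamma = 1, then X^s and Y^s are already central in J and W'' = 1
    ([wamsley_der2]).

    Lower bound. Permutations x, y, z of a finite set that satisfy the
    relations generate a homomorphic image of W, so it is enough to find such
    permutations with a nontrivial second derived subgroup. They are obtained
    by letting W act on cosets X^a Y^b Z^c H, on which X, Z and the inverse of
    Y act by
      (a + 1, b, c), (a / alpha, alpha b, c + 1), ([a], m^a (b - 1), c + gamma a),
    where [a] = 1 + m^-1 + ... + m^-(a - 1). All the relations but Z Y Z^-1 =
    Y^alpha hold identically, and that one holds modulo suitable lattices of
    triples.
    - Modulo m - 1 the map [a] is the identity, and one gets extensions of
      Heisenberg groups ([heisenberg_model]). There [X^s, Y^s] = C^(s^2) is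
      nontrivial unless m - 1 divides s^2. That divisibility forces gamma = 1,
      or alpha = -1, or one of three sporadic pairs ([dvdz_expn_pred_cases]).
    - If gamma = 1 and s does not divide 12, the reduced numerator of s / 12 has
      a prime factor, and the expansions of [a] and m^a in powers of s / 12 can
      be stopped after the second order. They give an action for which X^(s^2),
      which lies in W'', is nontrivial ([truncated_model]).
    - The remaining eleven pairs are checked on explicit tables
      ([Table.table_model_cases]). *)

(** * Geometric sums *)

Definition geom (m k : nat) : nat := \sum_(i < k) m ^ i.

(** The commutator of [x ^+ k] and y differs from the power [~ x, y] ^+ k by the
    inverse of x ^+ (m.-1 * wgeom m k), see [macdonald_commX]. *)
Definition wgeom (m k : nat) : nat := \sum_(i < k) i * m ^ i.

Lemma geom_rec m k : geom m k.+1 = m * geom m k + 1.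
Proof.
rewrite /geom big_ord_recl expn0 addnC; congr (_ + 1).
by rewrite big_distrr; apply: eq_bigr => i _; rewrite expnS.
Qed.

Lemma geomS m k : geom m k.+1 = geom m k + m ^ k.
Proof. by rewrite /geom big_ord_recr. Qed.

Lemma wgeomS m k : wgeom m k.+1 = wgeom m k + k * m ^ k.
Proof. by rewrite /wgeom big_ord_recr. Qed.

Lemma geomE m k : 0 < m -> m ^ k = m.-1 * geom m k + 1.
Proof.
by move=> m0; rewrite -predn_exp addn1 prednK // expn_gt0 m0.
Qed.

Lemma wgeomE m k : 0 < m -> m.-1 * wgeom m k + m * geom m k = k * m ^ k.
Proof.
move=> m0; elim: k => [|k IH]; first by rewrite /wgeom /geom !big_ord0 !muln0.
rewrite wgeomS geom_rec mulSn expnS !mulnDr muln1.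
have -> : k * (m * m ^ k) = k * (m.-1 * m ^ k + m ^ k) by rewrite -mulSnr prednK.
have := geomE k m0; case: m m0 IH => // m _ /= IH E.
rewrite E in IH *; nia.
Qed.

Local Open Scope group_scope.

(** * The Wamsley relations in a finite group *)

(** The integer exponent of the presentation is replaced by a natural number
    congruent to it. Conjugating y by the inverse of z makes the relations
    symmetric under the exchange of x and y together with the inversion of z. *)
Definition wamsley (gT : finGroupType) (a g : nat) (x y z : gT) : Prop :=
  [/\ x ^ z = x ^+ a, y ^ z^-1 = y ^+ a & z ^+ g = [~ x, y]].

Definition macdonald (gT : finGroupType) (m : nat) (x y : gT) : Prop :=
  x ^ [~ x, y] = x ^+ m /\ y ^ [~ y, x] = y ^+ m.

Section Macdonald.

Variables (gT : finGroupType) (m : nat).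
Implicit Types x y z : gT.

Lemma macdonald_sym x y : macdonald m x y -> macdonald m y x.
Proof. by case. Qed.

Lemma conjgXX x z n k : x ^ z = x ^+ n -> (x ^+ k) ^ z = x ^+ (n * k).
Proof. by move=> xz; rewrite conjXg xz expgM. Qed.

Lemma conjg_iter x z n j : x ^ z = x ^+ n -> x ^ (z ^+ j) = x ^+ (n ^ j).
Proof.
move=> xz; elim: j => [|j IH]; first by rewrite expg0 conjg1 expn0 expg1.
by rewrite expgSr conjgM IH (conjgXX _ xz) expnS.
Qed.

(** Indeed x ^ y = x * [x, y], and [x, y] acts on the powers of x. *)
Lemma macdonald_expJ x y k : macdonald m x y ->
  (x ^+ k) ^ y = [~ x, y] ^+ k * x ^+ (m * geom m k).
Proof.
case=> xc _; rewrite conjXg.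
have -> : x ^ y = x * [~ x, y] by rewrite commgEl mulKVg.
set c := [~ x, y] in xc *.
elim: k => [|k IH]; first by rewrite !expg0 /geom big_ord0 muln0 expg0 mulg1.
rewrite [LHS]expgSr IH mulgA -(mulgA (c ^+ k)) -expgSr -!mulgA.
rewrite (conjgC (x ^+ _) c) (conjgXX _ xc) mulgA -expgSr geom_rec.
by rewrite addn1.
Qed.

Lemma macdonald_commX x y k : 0 < m -> macdonald m x y ->
  [~ x ^+ k, y] = [~ x, y] ^+ k * (x ^+ (m.-1 * wgeom m k))^-1.
Proof.
move=> m0 M; rewrite commgEl (macdonald_expJ k M) mulgA.
have -> : (x ^+ k)^-1 * [~ x, y] ^+ k = [~ x, y] ^+ k * ((x ^+ k)^-1) ^ ([~ x, y] ^+ k).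
  by rewrite -conjgC.
rewrite -mulgA; congr (_ * _); rewrite conjVg.
have [xc _] := M; rewrite conjXg (conjg_iter _ xc) -expgM mulnC -(wgeomE k m0).
by rewrite addnC expgD invMg mulgKV.
Qed.

End Macdonald.

Lemma norm_cycle_expg (gT : finGroupType) (x z : gT) n :
  x ^ z = x ^+ n -> z \in 'N(<[x]>).
Proof. by move=> xz; rewrite inE -cycleJ xz cycle_subG mem_cycle. Qed.

Section WamsleyCentral.

Variables (gT : finGroupType) (a g : nat).
Hypotheses (a_gt0 : 0 < a).
Implicit Types x y z : gT.

Local Notation m := (a ^ g)%N.

Lemma wamsley_sym x y z : wamsley a g x y z -> wamsley a g y x z^-1.
Proof.
by case=> xz yz zg; split; rewrite ?invgK // expgVn zg invgR.
Qed.

Lemma wamsley_macdonald x y z : wamsley a g x y z -> macdonald m x y.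
Proof.
case=> xz yz zg; split; first by rewrite -zg (conjg_iter g xz).
by rewrite -invgR -zg -expgVn (conjg_iter g yz).
Qed.

(** The source of all central elements: both computations of y ^ (x ^+ k) end
    with a power of a conjugate of y, and comparing them leaves a power of x
    that is a power of y. *)
Lemma wamsley_commute x y z j (k := (a ^ j)%N) : wamsley a g x y z ->
  commute (x ^+ (m.-1 * wgeom m k)) y.
Proof.
move=> Wr; have M := wamsley_macdonald Wr; case: (Wr) => xz yz zg.
have m0 : 0 < m by rewrite expn_gt0 a_gt0.
set c := [~ x, y]; set w := x ^+ _.
have cz : c ^ (z ^+ j) = c.
  by rewrite /c -zg; apply/conjg_fixP/commgP/commuteX2.
have E1 : y ^ (x ^+ k) = y * w * (c ^+ k)^-1.
  rewrite conjg_mulR -mulgA; congr (_ * _).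
  by rewrite -invgR (macdonald_commX k m0 M) invMg invgK.
(* now with x ^+ k written as the conjugate of x by z ^+ j *)
have [e E2] : exists e, y ^ (x ^+ k) = (c ^+ k)^-1 * (y ^ (z ^+ j)) ^+ e.
  exists (m * geom m k)%N.
  have -> : x ^+ k = (z ^+ j)^-1 * (x * z ^+ j) by rewrite -conjgE (conjg_iter j xz).
  rewrite !conjgM -expgVn (conjg_iter j yz).
  rewrite (macdonald_expJ _ (macdonald_sym M)) -invgR -/c conjMg !conjXg conjVg cz.
  by rewrite expgVn.
have Ny : z ^+ j * c ^+ k \in 'N(<[y]>).
  have Nz : z \in 'N(<[y]>) by rewrite -groupV (norm_cycle_expg yz).
  by rewrite groupM ?groupX // /c -zg groupX.
have : w = y^-1 * (y ^ (z ^+ j * c ^+ k)) ^+ e.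
  rewrite conjgM -conjXg [_ ^ (c ^+ k)]conjgE (mulgA (c ^+ k)^-1) -E2 E1.
  by rewrite mulgKV mulKg.
move=> wE; have : w \in <[y]>.
  by rewrite wE groupM ?groupV ?groupX ?cycle_id // memJ_norm ?cycle_id.
by case/cycleP=> i ->; apply/commute_sym/commuteX.
Qed.

Lemma macdonald_commute_expn n x y e : 0 < n -> macdonald n x y ->
  commute (x ^+ e) y -> x ^+ (n.-1 * e) = 1.
Proof.
move=> n0 [xc _] xy; apply: (mulIg (x ^+ e)).
rewrite mul1g -expgD addnC -mulSn prednK // -(conjgXX e xc).
apply/conjg_fixP/commgP/cent1P; rewrite cent1C groupR //; apply/cent1P.
  exact: commuteX.
exact: commute_sym.
Qed.

(** Conjugating x ^+ N = 1 by y shows that [x, y] ^+ N is a power of x, hence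
    commutes with x. *)
Lemma macdonald_order n x y : 0 < n -> macdonald n x y ->
  (#[x] %| (n ^ #[x]).-1)%N.
Proof.
move=> n0 M; set N := #[x].
have := macdonald_expJ N M; rewrite expg_order conj1g => /esym/eqP.
rewrite -eq_invg_mul => /eqP cN.
have : x ^ (([~ x, y] ^+ N)^-1) = x.
  by apply/conjg_fixP/commgP; rewrite cN; apply: commuteX.
move/(canRL (conjgKV _)); have [xc _] := M; rewrite (conjg_iter N xc) => /esym xN.
have nN_gt0 : 0 < n ^ N by rewrite expn_gt0 n0.
rewrite order_dvdn; apply/eqP/(mulIg x).
by rewrite mul1g -expgSr prednK.
Qed.

(** The number d is the order of x modulo the centraliser of y in <[x]>. *)
Lemma commute_exponents x y : exists d,
  forall e, (d %| e)%N = (x ^+ e \in 'C[y]).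
Proof.
pose H := ('C[y] :&: <[x]>)%G; exists #[coset H x] => e.
have Nx : x \in 'N(H).
  apply: (subsetP (cents_norm _)); last exact: cycle_id.
  by rewrite centsC; apply: subset_trans (subsetIr _ _) (cycle_abelian x).
rewrite order_dvdn -morphX //.
have -> : (coset H (x ^+ e) == 1) = (x ^+ e \in H).
  apply/eqP/idP => [eH|].
    exact: (coset_idr (groupX _ Nx) eH).
  exact: coset_id.
by rewrite inE mem_cycle andbT.
Qed.

End WamsleyCentral.

Local Close Scope group_scope.

(** * The exponents of the central powers *)

Lemma totient_lt D : 1 < D -> totient D < D.
Proof.
case: D => // D; rewrite ltnS => D0; rewrite totient_count_coprime big_ltn //.
rewrite /coprime gcdn0 eqSS (gtn_eqF D0) add0n ltnS.
apply: (@leq_trans (\sum_(1 <= d < D.+1) 1)); last by rewrite sum_nat_const_nat; lia.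
by apply: leq_sum => i _; apply: leq_b1.
Qed.

Lemma eqn_mod_dvd1 p k : 0 < k -> (k == 1 %[mod p]) = (p %| k.-1).
Proof. by move=> k0; rewrite eqn_mod_dvd // subn1. Qed.

Lemma expn_mod1 p b i j : b ^ i = 1 %[mod p] -> b ^ (i * j) = 1 %[mod p].
Proof. by move=> bi; rewrite expnM -modnXm bi modnXm exp1n. Qed.

Lemma expn_mod1_gcd p b i j : 0 < i ->
  b ^ i = 1 %[mod p] -> b ^ j = 1 %[mod p] -> b ^ gcdn i j = 1 %[mod p].
Proof.
move=> i0 bi bj; case: (egcdnP j i0) => u v uE _.
have := expn_mod1 u bi; rewrite mulnC uE expnD -modnMml mulnC.
by rewrite (mulnC v) (expn_mod1 v bj) modnMmr muln1.
Qed.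

(** Let D be a divisor of N such that m ^ D = 1 modulo p, and let k be the power
    of a with exponent [totient D], so that k = 1 modulo D. If p does not divide
    m - 1, the hypothesis on the weighted sums makes k = 1 modulo p, hence
    m ^ totient D = 1 modulo p, and D can be replaced by the smaller number
    gcdn D (totient D). The descent ends at D = 1, where p divides m - 1. *)
Lemma prime_dvd_pred p a g N : prime p -> 0 < a -> 0 < N ->
    let m := a ^ g in
    N %| (m ^ N).-1 -> p %| N ->
    (forall j, p %| m.-1 * wgeom m (a ^ j)) -> p %| m.-1.
Proof.
move=> pp a0 N0 m Nm pN Hw.
have m0 : 0 < m by rewrite expn_gt0 a0.
have mk0 k : 0 < m ^ k by rewrite expn_gt0 m0.
have mN : m ^ N = 1 %[mod N] by apply/eqP; rewrite eqn_mod_dvd1.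
have co_mN : coprime N m.
  rewrite /coprime -dvdn1.
  have mE : m ^ N = m * m ^ N.-1 by rewrite -expnS prednK.
  have : gcdn N m %| (m ^ N).-1.+1.
    by rewrite prednK // mE dvdn_mulr // dvdn_gcdr.
  rewrite -addn1 dvdn_addr //; exact: dvdn_trans (dvdn_gcdl _ _) Nm.
have co_mp : coprime p m by apply: coprime_dvdl co_mN.
suff D_ind D : D %| N -> m ^ D = 1 %[mod p] -> p %| m.-1.
  apply: (D_ind N) => //; apply/eqP; rewrite eqn_mod_dvd1 //.
  exact: dvdn_trans Nm.
elim/ltn_ind: D => D IH DN mD.
have D0 : 0 < D := dvdn_gt0 N0 DN.
have [D1|D1] := leqP D 1.
  move: mD; have -> : D = 1 by lia.
  by rewrite expn1 => /eqP; rewrite eqn_mod_dvd1.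
have [//|pn] := boolP (p %| m.-1).
have co_aD : coprime D a.
  have [g0|g0] := posnP g; first by move: pn; rewrite /m g0 expn0 dvdn0.
  by apply: coprime_dvdl DN _; move: co_mN; rewrite coprime_pexpr.
pose e := totient D; pose k := a ^ e.
have kD : k = 1 %[mod D] by apply: Euler_exp_totient; rewrite coprime_sym.
have k0 : 0 < k by rewrite expn_gt0 a0.
have [w kE] : exists w, k = 1 + D * w.
  move/eqP: kD; rewrite eqn_mod_dvd1 // => /dvdnP[w wE].
  by exists w; rewrite mulnC -wE add1n prednK.
have mk : m ^ k = m %[mod p].
  by rewrite kE expnD expn1 -modnMmr (expn_mod1 w mD) modnMmr muln1.
(* reading the weighted sum modulo p gives n k = n, whence k = 1 modulo p *)
have pk : p %| k.-1.
  have E1 := wgeomE k m0; have E2 := geomE k m0.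
  have /dvdnP[v vE] := Hw e; rewrite -/k in vE.
  have E3 : m * (m ^ k) + p * (v * m.-1) = m + m.-1 * (k * m ^ k).
    rewrite -E1 E2 mulnDr muln1 mulnDr vE; lia.
  have /eqP : m * m = m + m.-1 * (k * m) %[mod p].
    have -> : m * m = m * m ^ k %[mod p] by rewrite -modnMmr -mk modnMmr.
    rewrite -(modnMDl (v * m.-1) (m * _)) mulnC addnC E3; apply/eqP.
    by rewrite eqn_modDl !mulnA -modnMmr mk modnMmr.
  have -> : m * m = m + m.-1 * m by case: (m) m0 => // m' _; rewrite mulSn.
  rewrite eqn_modDl.
  have le : m.-1 * m <= m.-1 * (k * m).
    by rewrite leq_mul2l; apply/orP; right; rewrite leq_pmull.
  rewrite eq_sym eqn_mod_dvd // -mulnBr.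
  have -> : k * m - m = k.-1 * m by case: (k) k0 => // k' _; rewrite mulSn addKn.
  by rewrite Euclid_dvdM // (negbTE pn) /= Gauss_dvdl.
have me : m ^ e = 1 %[mod p].
  rewrite /m -expnM mulnC expnM; apply/eqP.
  rewrite eqn_mod_dvd1; last by rewrite !expn_gt0 a0.
  by rewrite -/k predn_exp dvdn_mulr.
rewrite -(negbTE pn); apply: (IH (gcdn D e)); last exact: expn_mod1_gcd.
- have e0 : 0 < e by rewrite totient_gt0.
  apply: leq_ltn_trans (dvdn_leq e0 (dvdn_gcdr D e)) _.
  exact: totient_lt.
- exact: dvdn_trans (dvdn_gcdl _ _) DN.
Qed.

Lemma expnS_expand3 n k : exists t,
  n.+1 ^ k = 1 + k * n + 'C(k, 2) * n ^ 2 + t * n ^ 3.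
Proof.
elim: k => [|k [t IH]]; first by exists 0.
exists ('C(k, 2) + n.+1 * t).
rewrite expnS IH binS bin1; ring.
Qed.

(** The derivative of [geom] in its first argument. It differs from [wgeom] by
    the factor m, and its expansion in powers of m - 1 is simpler. *)
Definition dgeom (m k : nat) := \sum_(i < k) i * m ^ i.-1.

Lemma dgeomS m k : dgeom m k.+1 = dgeom m k + k * m ^ k.-1.
Proof. by rewrite /dgeom big_ord_recr. Qed.

Lemma wgeom_dgeom m k : wgeom m k = m * dgeom m k.
Proof.
rewrite /wgeom /dgeom big_distrr; apply: eq_bigr => -[[|i] _] _ /=.
  by rewrite mul0n muln0.
by rewrite expnS mulnCA.
Qed.

Lemma dgeom_expand n k : exists t,
  dgeom n.+1 k =
    'C(k, 2) + 2 * n * 'C(k, 3) + 3 * n ^ 2 * 'C(k, 4) + n ^ 3 * t.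
Proof.
elim: k => [|k [t IH]]; first by exists 0; rewrite /dgeom big_ord0 !bin_small // !muln0.
case: k IH => [|k] IH; first by exists 0; rewrite /dgeom big_ord1 !bin_small // !muln0.
have [u uE] := expnS_expand3 n k.
exists (t + k.+1 * u); rewrite dgeomS IH uE.
have E2 := mul_bin_diag k.+1 1; have E3 := mul_bin_diag k.+1 2.
rewrite (binS k.+1 1) (binS k.+1 2) (binS k.+1 3) bin1 /= bin1 in E2 *.
rewrite /= in E3; move: E2 E3.
move: 'C(k.+1, 2) 'C(k.+1, 3) 'C(k.+1, 4) 'C(k, 2) => c2 c3 c4 b2 E2 E3.
have -> : k.+1 * (1 + k * n + b2 * n ^ 2 + u * n ^ 3) =
  k.+1 + (k.+1 * k) * n + (k.+1 * b2) * n ^ 2 + k.+1 * u * n ^ 3 by ring.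
rewrite E2 E3; ring.
Qed.

Lemma dgeom24 n k : 1 < k -> exists t,
  24 * dgeom n.+1 k =
    k * k.-1 * (12 + 8 * n * k.-2 + 3 * n ^ 2 * (k.-2 * k.-2.-1)) + 24 * n ^ 3 * t.
Proof.
case: k => [|[|q]] // _; have [t tE] := dgeom_expand n q.+2; exists t.
have E2 := bin_ffact q.+2 2; have E3 := bin_ffact q.+2 3.
have E4 := bin_ffact q.+2 4.
rewrite !(ffactnS, ffactn0) muln1 !factS fact0 in E2 E3 E4.
rewrite tE; move: E2 E3 E4.
move: 'C(q.+2, 2) 'C(q.+2, 3) 'C(q.+2, 4) => c2 c3 c4 /= E2 E3 E4.
have -> : 24 * (c2 + 2 * n * c3 + 3 * n ^ 2 * c4 + n ^ 3 * t) =
  12 * (c2 * 2) + 8 * n * (c3 * 6) + 3 * n ^ 2 * (c4 * 24) + 24 * n ^ 3 * t by ring.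
rewrite E2 E3 E4; ring.
Qed.

(** The remainder of order 4 in the expansion of n * dgeom is harmless as long as
    p ^ T divides n ^ 4. *)
Lemma dvd_dgeom p T n k : 1 < k -> 0 < n -> prime p ->
    p ^ T %| n * dgeom n.+1 k -> T <= 4 * logn p n ->
  T + logn p 24 <= logn p k + logn p k.-1 + logn p n +
     logn p (12 + 8 * n * k.-2 + 3 * n ^ 2 * (k.-2 * k.-2.-1)).
Proof.
move=> k1 n0 pp dv Tle; have [t tE] := dgeom24 n k1.
set B := 12 + _ + _ in tE *.
have k0 : 0 < k := ltnW k1; have k'0 : 0 < k.-1 by case: (k) k1 => [|[]].
have B0 : 0 < B by rewrite /B.
rewrite -!lognM ?muln_gt0 ?k0 ?k'0 ?n0 //.
have -> : T + logn p 24 = logn p (24 * p ^ T).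
  have p0 : 0 < p ^ T by rewrite expn_gt0 prime_gt0.
  by rewrite (@lognM p 24 _ isT p0) (pfactorK T pp) addnC.
apply: dvdn_leq_log; first by rewrite !muln_gt0 k0 k'0 n0 B0.
have dn4 : p ^ T %| n ^ 4 by rewrite pfactor_dvdn ?expn_gt0 ?n0 // lognX.
rewrite -(@dvdn_addl (24 * n ^ 4 * t)); last first.
  by rewrite dvdn_mulr // dvdn_pmul2l.
have -> : k * k.-1 * n * B + 24 * n ^ 4 * t = 24 * (n * dgeom n.+1 k).
  by rewrite mulnCA tE; ring.
by rewrite dvdn_pmul2l.
Qed.

Lemma logn_bracket2 n q : 2 %| n ->
  logn 2 (12 + 8 * n * q + 3 * n ^ 2 * (q * q.-1)) = 2.
Proof.
case/dvdnP=> n1 ->.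
have [v vE] : exists v, q * q.-1 = 2 * v.
  exists (q * q.-1)./2; rewrite mul2n even_halfK //.
  by case: (q) => // k; rewrite oddM /= andNb.
have -> : 12 + 8 * (n1 * 2) * q + 3 * (n1 * 2) ^ 2 * (q * q.-1) =
  2 ^ 2 * (2 * (1 + 2 * n1 * q + 3 * n1 ^ 2 * v) + 1) by rewrite vE; ring.
rewrite lognM ?addn1 // (pfactorK 2) //.
by rewrite logn_coprime ?addn0 // coprime2n oddS oddM.
Qed.

Lemma logn3_lt2 b : 0 < b -> ~~ (9 %| b) -> logn 3 b <= 1.
Proof. by move=> b0; rewrite leqNgt; apply: contra => l; rewrite -[9]/(3 ^ 2) pfactor_dvdn. Qed.

Section Valuation.

Variables (a g d : nat).
Hypotheses (a_gt1 : 1 < a) (g_gt0 : 0 < g).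
Local Notation m := (a ^ g).
Local Notation n := (a ^ g).-1.
Local Notation s := a.-1.

Hypothesis dW : forall j, d %| n * wgeom m (a ^ j).

Lemma pred_dvd_pred_expn j : s %| (a ^ j).-1.
Proof. by rewrite predn_exp dvdn_mulr. Qed.

Lemma pred_expn_gt0 : 0 < n.
Proof. by rewrite -subn1 subn_gt0 -(exp1n g) ltn_exp2r. Qed.

Lemma pred_gt0 : 0 < s.
Proof. by case: a a_gt1 => [|[]]. Qed.

(** Here m is prime to p, so that [dgeom] may replace [wgeom]. *)
Lemma logn_dgeom_le p T j : prime p -> p %| n -> 0 < j ->
    p ^ T %| d -> T <= 4 * logn p n ->
  T + logn p 24 <= logn p (a ^ j).-1 + logn p n +
     logn p (12 + 8 * n * (a ^ j).-2 + 3 * n ^ 2 * ((a ^ j).-2 * (a ^ j).-2.-1)).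
Proof.
move=> pp pn j0 pd Tle.
have aj1 : 1 < a ^ j by rewrite -(exp1n j) ltn_exp2r.
have m0 : 0 < m by rewrite expn_gt0 ltnW.
have co_pm : coprime p m.
  rewrite prime_coprime //; apply/negP => pm; have := dvdn_sub pm pn.
  by rewrite -[X in X - _](prednK m0) subSnn dvdn1 => /eqP p1; rewrite p1 in pp.
have co_pa : coprime p a by move: co_pm; rewrite coprime_pexpr.
have := @dvd_dgeom p T n (a ^ j) aj1 pred_expn_gt0 pp; rewrite (prednK m0).
have -> : logn p (a ^ j) = 0 by rewrite logn_coprime // coprimeXr.
apply=> //; have := dvdn_trans pd (dW j).
by rewrite wgeom_dgeom mulnCA Gauss_dvdr // coprimeXl.
Qed.

(** The bracket in [logn_dgeom_le] is 12 modulo p for p > 3 and 4 modulo 8 for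
    p = 2. For p = 3 it may be divisible by a high power of 3 when 3 divides s;
    but then the brackets for the exponents a and a ^ 2 cannot both be divisible
    by 27, and only one factor 3 is lost. *)
Lemma logn_central p : prime p -> p %| n -> 0 < d ->
  logn p d <= logn p (gcdn 3 s) + logn p s + logn p n - (p == 2).
Proof.
move=> pp pn d0; set t := logn p d.
have pT T : T <= t -> p ^ T %| d by move=> Tt; rewrite pfactor_dvdn.
have m0 : 0 < logn p n by rewrite logn_gt0 mem_primes pp pred_expn_gt0.
have sn : s %| n := pred_dvd_pred_expn g.
have ls : logn p s <= logn p n by apply: dvdn_leq_log => //; apply: pred_expn_gt0.
have step T j := @logn_dgeom_le p T j pp pn.
have am : (12 + 8 * n * a.-2 + 3 * n ^ 2 * (a.-2 * a.-2.-1)) > 0 by [].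
have step1 T : T <= t -> T <= 4 * logn p n -> T + logn p 24 <= logn p s + logn p n +
     logn p (12 + 8 * n * a.-2 + 3 * n ^ 2 * (a.-2 * a.-2.-1)).
  by move=> Tt T4; have := step T 1; rewrite expn1; apply=> //; apply: pT.
rewrite leqNgt; apply/negP => lt.
have [p2|p2] := eqVneq p 2.
  subst p; have := step1 (logn 2 s + logn 2 n).
  rewrite logn_bracket2 // (_ : logn 2 24 = 3) //.
  by rewrite eqxx in lt; move: lt m0 ls; rewrite -/t; lia.
rewrite (negbTE p2) subn0 in lt.
have [p3|p3] := eqVneq p 3; last first.
  have := step1 (logn p s + logn p n).+1.
  have -> : logn p 24 = 0.
    rewrite logn_coprime // prime_coprime // -[24]/(2 ^ 3 * 3) Euclid_dvdM // Euclid_dvdX // !dvdn_prime2 // (negbTE p2) (negbTE p3) //.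
  have -> : logn p (12 + 8 * n * a.-2 + 3 * n ^ 2 * (a.-2 * a.-2.-1)) = 0.
    rewrite logn_coprime // prime_coprime // -addnA dvdn_addl; last first.
      have pn2 : p %| n ^ 2 by rewrite Euclid_dvdX // pn.
      exact: dvdn_add (dvdn_mulr _ (dvdn_mull _ pn)) (dvdn_mulr _ (dvdn_mull _ pn2)).
    by rewrite -[12]/(2 ^ 2 * 3) Euclid_dvdM // Euclid_dvdX // !dvdn_prime2 // (negbTE p2) (negbTE p3) //.
  move: lt m0 ls; rewrite -/t; lia.
subst p; have [s3|s3] := boolP (3 %| s); last first.
  (* a is then congruent to 2 modulo 3 *)
  have := step1 (logn 3 n).+1; rewrite (_ : logn 3 24 = 1) //.
  have -> : logn 3 s = 0 by rewrite logn_coprime // prime_coprime.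
  have : logn 3 (12 + 8 * n * a.-2 + 3 * n ^ 2 * (a.-2 * a.-2.-1)) <= 1.
    apply: logn3_lt2 => //.
    have a3 : ~~ (3 %| a).
      apply/negP => a3; have := dvdn_sub (dvdn_exp g_gt0 a3) pn.
      by rewrite -[X in X - _]prednK ?expn_gt0 ?(ltnW a_gt1) // subSnn.
    have [u uE] : exists u, a.-2 = 3 * u by exists (a.-2 %/ 3); move: s3 a3 a_gt1; lia.
    case/dvdnP: pn => v ->; rewrite uE.
    have -> : 12 + 8 * (v * 3) * (3 * u) + 3 * (v * 3) ^ 2 * (3 * u * (3 * u).-1) =
      3 + 9 * (1 + 8 * v * u + 9 * v ^ 2 * u * (3 * u).-1) by ring.
    by rewrite dvdn_addl ?dvdn_mulr.
  move: lt m0 ls; rewrite -/t; lia.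
have g3 : logn 3 (gcdn 3 s) = 1 by rewrite (gcdn_idPl s3) logn_prime.
rewrite g3 in lt.
have l27 j : 0 < j -> logn 3 (a ^ j).-1 = logn 3 s ->
    27 %| 12 + 8 * n * (a ^ j).-2 + 3 * n ^ 2 * ((a ^ j).-2 * (a ^ j).-2.-1).
  move=> j0 lj; rewrite -[27]/(3 ^ 3) pfactor_dvdn //.
  have := step (logn 3 s + logn 3 n).+2 j j0; rewrite (_ : logn 3 24 = 1) // lj.
  have := pT (logn 3 s + logn 3 n).+2; move: lt m0 ls; rewrite -/t.
  by move: (logn 3 (_ + _ + _)) => b; lia.
have [w wE] : exists w, a = 3 * w + 4.
  by exists ((a - 4) %/ 3); move: s3 a_gt1; lia.
case/dvdnP: (pn) => v vE.
have dvd_q j : 0 < j -> logn 3 (a ^ j).-1 = logn 3 s -> 9 %| 4 + 8 * v * (a ^ j).-2.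
  move=> j0 lj; have := l27 j j0 lj; rewrite vE.
  move: (_.-2) => q; rewrite -(@dvdn_pmul2l 3 9) // -[3 * 9]/27.
  have -> : 12 + 8 * (v * 3) * q + 3 * (v * 3) ^ 2 * (q * q.-1) =
    3 * (4 + 8 * v * q) + 27 * (v ^ 2 * (q * q.-1)) by ring.
  by rewrite dvdn_addl // dvdn_mulr.
have lq2 : logn 3 (a ^ 2).-1 = logn 3 s.
  have -> : (a ^ 2).-1 = s * a.+1 by rewrite -subn1 -(exp1n 2) subn_sqr subn1 addn1.
  rewrite lognM ?pred_gt0 // (@logn_coprime 3 a.+1) ?addn0 //.
  by rewrite prime_coprime // wE; lia.
have := dvd_q 2 isT lq2; have := dvd_q 1 isT; rewrite expn1 => /(_ erefl).
have -> : a.-2 = 3 * w + 2 by rewrite wE; lia.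
have -> : (a ^ 2).-2 = 9 * w ^ 2 + 24 * w + 14.
  by rewrite wE (_ : _ ^ 2 = (9 * w ^ 2 + 24 * w + 14).+2) //; ring.
move=> dv1 dv2.
have v3 : v %% 3 = 2.
  have : 3 %| 4 + 8 * v * (3 * w + 2) by apply: dvdn_trans dv1.
  have -> : 4 + 8 * v * (3 * w + 2) = 3 * (8 * v * w + 1 + 5 * v) + (v + 1) by ring.
  by rewrite dvdn_addr ?dvdn_mulr //; move: (v) => v'; lia.
(* subtracting the two congruences leaves 9 | 24 v (7 w + 4) *)
have : 9 %| 24 * (v * (7 * w + 4)).
  rewrite -(dvdn_addr _ dv1).
  have -> : 4 + 8 * v * (3 * w + 2) + 24 * (v * (7 * w + 4)) =
    4 + 8 * v * (9 * w ^ 2 + 24 * w + 14) - 9 * (8 * v * w ^ 2).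
    by rewrite -(addnK (9 * (8 * v * w ^ 2)) (4 + _ + _)); congr (_ - _); ring.
  by apply: dvdn_sub => //; rewrite dvdn_mulr.
rewrite -[9]/(3 * 3) -[24]/(3 * 8) -mulnA dvdn_pmul2l // Gauss_dvdr //.
rewrite Euclid_dvdM // => /orP[v3'|w3]; first by move: v3'; rewrite /dvdn v3.
have : 9 %| n by apply: dvdn_trans sn; rewrite wE; move: w3; lia.
rewrite vE -[9]/(3 * 3) dvdn_pmul2r //; by rewrite /dvdn v3.
Qed.

End Valuation.

(** In the application N is the order of x, and d generates the ideal of the
    exponents e such that x ^+ e is central in J. *)
Lemma central_exponent (a g N d : nat) : 1 < a -> 0 < g -> 0 < N ->
    let m := a ^ g in
    d %| N -> N %| (m ^ N).-1 -> (forall j, d %| m.-1 * wgeom m (a ^ j)) ->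
  forall e, gcdn 3 a.-1 * a.-1 * m.-1 %| 2 * e -> d %| e.
Proof.
move=> a1 g0 N0 m dN Nm dW e He; have d0 : 0 < d := dvdn_gt0 N0 dN.
have [->//|e0] := posnP e; apply/dvdn_partP=> // p; rewrite mem_primes d0 /=.
case/andP=> pp pd; have pN := dvdn_trans pd dN.
have pn : p %| m.-1.
  apply: (prime_dvd_pred pp (ltnW a1) N0 Nm pN) => j.
  exact: dvdn_trans pd (dW j).
rewrite p_part pfactor_dvdn //; apply: leq_trans (logn_central a1 g0 dW pp pn d0) _.
have s0 := pred_gt0 a1; have n0 := pred_expn_gt0 a1 g0.
have r0 : 0 < gcdn 3 a.-1 by rewrite gcdn_gt0.
have := dvdn_leq_log p _ He; rewrite !lognM ?muln_gt0 ?r0 ?s0 ?n0 ?e0 //.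
have -> : logn p 2 = (p == 2) by rewrite logn_prime // eq_sym.
by rewrite leq_subLR => /(_ isT).
Qed.

(** * Macdonald groups with many trivial powers *)

Lemma expnS_mod s n k : s %| n -> n.+1 ^ k = 1 %[mod s].
Proof.
move=> sn; have n1 : n.+1 = 1 %[mod s] by rewrite -addn1 -modnDml (eqP sn).
by rewrite -modnXm n1 modnXm exp1n.
Qed.

Lemma dvdn_geom s n k : s %| n -> s %| k -> s %| geom n.+1 k.
Proof.
move=> sn sk; suff E : geom n.+1 k = k %[mod s] by rewrite /dvdn E.
elim: k {sk} => [|k IH]; first by rewrite /geom big_ord0.
by rewrite geomS -modnDml IH modnDml -modnDmr (expnS_mod k sn) modnDmr addn1.
Qed.

Lemma geomD m i j : geom m (i + j) = geom m i + m ^ i * geom m j.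
Proof.
elim: j => [|j IH]; first by rewrite addn0 {3}/geom big_ord0 muln0 addn0.
by rewrite addnS !geomS IH mulnDr -expnD addnA.
Qed.

Lemma geomM m i j : geom m (i * j) = geom m i * geom (m ^ i) j.
Proof.
elim: j => [|j IH]; first by rewrite muln0 /geom !big_ord0 muln0.
by rewrite mulnS addnC geomD IH geomS mulnDr -expnM (mulnC (m ^ _)).
Qed.

Lemma dvdn_geomM s n : s %| n -> s * n %| geom n.+1 (s * n).
Proof.
move=> sn; rewrite geomM; apply: dvdn_mul; first exact: dvdn_geom.
rewrite -[_ ^ s]prednK ?expn_gt0 //; apply: dvdn_geom => //.
by rewrite predn_exp dvdn_mulr.
Qed.

Lemma dvdn_double_wgeom s n k : s %| n -> s %| k -> s %| 2 * wgeom n.+1 k.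
Proof.
move=> sn sk; suff E : 2 * wgeom n.+1 k = k * k.-1 %[mod s].
  by rewrite /dvdn E; apply: dvdn_mulr.
elim: k {sk} => [|k IH]; first by rewrite /wgeom big_ord0.
rewrite wgeomS mulnDr -modnDml IH modnDml -modnDmr mulnA -modnMmr.
rewrite (expnS_mod k sn) modnMmr modnDmr muln1.
by congr (_ %% _); case: k {IH} => // k /=; ring.
Qed.

Lemma wgeom_expand n k : exists t,
  6 * wgeom n.+1 k.+1 = 3 * (k.+1 * k) + n * (k.+1 * k) * (2 * k).+1 + 6 * n ^ 2 * t.
Proof.
elim: k => [|k [t IH]]; first by exists 0; rewrite /wgeom big_ord1 mul0n !muln0 mul0n.
have [u uE] := expnS_expand3 n k.+1.
exists (t + k.+1 * ('C(k.+1, 2) + u * n)); rewrite wgeomS mulnDr IH uE; ring.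
Qed.

(** For r = 3 the claim is multiplied by 3 and read off [wgeom_expand]. *)
Lemma dvdn_double_wgeomM r s n : r %| 3 -> r %| s -> s %| n ->
  r * s %| 2 * wgeom n.+1 (s * n).
Proof.
move=> r3 rs sn; have [r1|r1] : r = 1 \/ r = 3.
- by move: (@dvdn_leq r 3 isT r3) (r3); case: (r) => [|[|[|[|q]]]] //; auto.
- by rewrite r1 mul1n dvdn_double_wgeom // dvdn_mulr.
rewrite {}r1 in rs *; have [->|] := posnP (s * n); first by rewrite /wgeom big_ord0.
move=> /prednK kE; have [t] := wgeom_expand n (s * n).-1; rewrite kE => E.
rewrite -(@dvdn_pmul2l 3) // [3 * (2 * _)]mulnA -[3 * 2]/6 E.
have [v vE] := dvdnP (dvdn_trans rs sn).
have ssn : 3 * s %| s * n by rewrite mulnC dvdn_mul // vE dvdn_mull.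
have nn : 3 * s %| n * n by rewrite dvdn_mul // vE dvdn_mull.
apply: dvdn_add; first apply: dvdn_add.
- by rewrite dvdn_pmul2l // dvdn_mulr.
- have -> : n * (s * n * (s * n).-1) * (2 * (s * n).-1).+1 =
    3 * (s * n * (v * (s * n).-1 * (2 * (s * n).-1).+1)) by move: (s * n).-1 => k; rewrite vE; ring.
  by rewrite dvdn_pmul2l // dvdn_mulr.
have -> : 6 * n ^ 2 * t = 3 * (n * n * (2 * t)) by ring.
by rewrite dvdn_pmul2l // dvdn_mulr.
Qed.

Local Open Scope group_scope.

Lemma der1_sub_gen (gT : finGroupType) (S : {set gT}) (Q : {group gT}) :
  S \subset 'N(Q) -> {in S &, forall u v, [~ u, v] \in Q} -> <<S>>^`(1) \subset Q.
Proof.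
move=> nQS cQ; apply: der1_min; rewrite ?gen_subG //.
rewrite quotient_gen // abelian_gen /abelian quotient_cents2 //.
by rewrite gen_subG; apply/subsetP=> _ /imset2P[u v Su Sv ->]; apply: cQ.
Qed.

Lemma commg_invr (gT : finGroupType) (u v : gT) :
  [~ u, v^-1] = ([~ u, v]^-1) ^ v^-1.
Proof. by rewrite commgEl [in RHS]commgEl invMg invgK [RHS]conjMg conjVg conjgK. Qed.

Lemma norm_gen1 (gT : finGroupType) (S : {set gT}) x :
  {in S, forall u, u ^ x \in <<S>>} -> x \in 'N(<<S>>).
Proof.
move=> Sx; rewrite inE -genJ gen_subG; apply/subsetP=> _ /imsetP[u Su ->].
exact: Sx.
Qed.

Lemma macdonald_morph (aT rT : finGroupType) (D : {group aT})
    (f : {morphism D >-> rT}) m x y :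
  x \in D -> y \in D -> macdonald m x y -> macdonald m (f x) (f y).
Proof.
move=> Dx Dy [xc yc].
by split; rewrite -morphR // -morphJ ?groupR // ?xc ?yc morphX.
Qed.

(** Under these hypotheses [X ^+ s, Y] = C ^+ s commutes with Y. *)
Lemma macdonald_commX_pow (gT : finGroupType) n (X Y : gT) s (C := [~ X, Y]) : s %| n ->
    macdonald n.+1 X Y ->
    (forall e, s * n %| 2 * e -> X ^+ e = 1) ->
    (forall e, s * n %| 2 * e -> Y ^+ e = 1) ->
  [~ X ^+ s, Y ^+ s] = C ^+ (s * s).
Proof.
move=> sn M X1 Y1; have [_ YC] := M.
have E : [~ X ^+ s, Y] = C ^+ s.
  rewrite (macdonald_commX s _ M) // X1 ?invg1 ?mulg1 //.
  by rewrite mulnCA mulnC dvdn_mul // dvdn_double_wgeom.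
rewrite commgX E -?expgM //.
apply/commgP/conjg_fixP.
rewrite -invgR -/C in YC.
have := conjg_iter s YC; rewrite expgVn geomE //= expgD expg1 Y1 ?mul1g.
  by move/(canRL (conjgKV _)).
by rewrite mulnCA mulnC dvdn_mul // dvdn_mull // dvdn_geom.
Qed.

Section MacdonaldQuotient.

Variables (gT : finGroupType) (n : nat).
Implicit Types X Y : gT.

Variables (r s : nat).
Hypotheses (r3 : r %| 3) (rs : r %| s) (sn : s %| n).

(** The situation in J modulo its centre. The factor r is 1 or 3; the exponents
    of the form s n become trivial as well only after a second quotient. *)
Definition collapsed X Y := macdonald n.+1 X Y /\
  forall e, (r * s * n %| 2 * e)%N -> X ^+ e = 1 /\ Y ^+ e = 1.

Lemma collapsed_sym X Y : collapsed X Y -> collapsed Y X.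
Proof. by case=> M H; split=> [|e /H[]//]; apply: macdonald_sym. Qed.

Lemma collapsed_rn : r %| n. Proof. exact: dvdn_trans rs sn. Qed.

Section CollapsedFacts.
Variables (X Y : gT).
Hypothesis (H : collapsed X Y).
Local Notation C := [~ X, Y].
Local Notation U := (X ^+ (s * n)).

Let M : macdonald n.+1 X Y. Proof. by case: H. Qed.
Let XC : X ^ C = X ^+ n.+1. Proof. by case: M. Qed.

Lemma collapsed_expX e : (r * s * n %| 2 * e)%N -> X ^+ e = 1.
Proof. by case: H => _ H1 /H1[]. Qed.

Lemma collapsed_commC e k : (r * s %| 2 * (e * geom n.+1 k))%N ->
  commute (X ^+ e) (C ^+ k).
Proof.
move=> d; apply/commgP/conjg_fixP; rewrite conjXg (conjg_iter k XC) geomE //=.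
rewrite -expgM addn1 mulSn expgD [X ^+ (_ * e)]collapsed_expX ?mulg1 //.
have -> : (2 * (n * geom n.+1 k * e) = 2 * (e * geom n.+1 k) * n)%N by ring.
exact: dvdn_mul.
Qed.

Lemma collapsed_commUY : [~ U, Y] = C ^+ (s * n).
Proof.
rewrite (macdonald_commX _ _ M) // collapsed_expX ?invg1 ?mulg1 //=.
by rewrite mulnCA mulnC dvdn_mul // dvdn_double_wgeomM.
Qed.

Lemma collapsed_commUC : commute U C.
Proof.
rewrite -[C]expg1; apply: collapsed_commC.
by rewrite dvdn_mull // dvdn_mulr // (mulnC r) dvdn_mul // collapsed_rn.
Qed.

Lemma collapsed_commXCn : commute X (C ^+ (s * n)).
Proof.
rewrite -{1}[X]expg1; apply: collapsed_commC.
rewrite mul1n dvdn_mull //; apply: dvdn_trans (dvdn_geomM sn).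
by rewrite mulnC dvdn_mul // collapsed_rn.
Qed.

(** [U, Y] is a power of C that is central, so its r-th power is the commutator
    of U ^+ r = 1 and Y. *)
Lemma collapsed_Cn : C ^+ (s * n * s) = 1.
Proof.
have [k kE] := dvdnP rs; rewrite {2}kE (mulnC k) mulnA expgM.
suff -> : C ^+ (s * n * r) = 1 by rewrite expg1n.
rewrite expgM -collapsed_commUY -commXg ?collapsed_commUY; last first.
  exact/commuteX/collapsed_commUC.
rewrite -expgM collapsed_expX ?comm1g //.
by rewrite dvdn_mull // (mulnC _ r) mulnA.
Qed.

Lemma collapsed_commXsC : [~ X ^+ s, C] = U.
Proof.
by rewrite commgEl conjXg XC -expgM mulSn (mulnC n) expgD mulKg.
Qed.

Lemma collapsed_commXsCss : commute (X ^+ s) (C ^+ (s * s)).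
Proof.
apply: collapsed_commC; rewrite dvdn_mull // mulnC dvdn_mul //.
by rewrite dvdn_geom ?dvdn_mulr // collapsed_rn.
Qed.

(** Since r divides 3, both X ^+ (2 e) and X ^+ (3 e) are known. *)
Lemma collapsed_exp_mem e : (s * n %| 2 * e)%N -> X ^+ e \in <[U]>.
Proof.
case/dvdnP=> w wE.
have : X ^+ (3 * e) = 1.
  apply: collapsed_expX; rewrite mulnCA wE -mulnA (mulnCA 3).
  by rewrite dvdn_mull // dvdn_mul.
rewrite mulSn expgD wE mulnC expgM => /(canRL (mulgK _)) ->.
by rewrite mul1g groupV mem_cycle.
Qed.

End CollapsedFacts.

Lemma collapsed_commYCn X Y : collapsed X Y -> commute Y ([~ X, Y] ^+ (s * n)).
Proof.
move=> H; have := collapsed_commXCn (collapsed_sym H).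
by rewrite -invgR expgVn => /commuteV; rewrite invgK.
Qed.

Lemma collapsed_commUYs X Y : collapsed X Y -> commute (X ^+ (s * n)) (Y ^+ s).
Proof.
move=> H; apply/commgP; rewrite commgX ?collapsed_commUY //.
  by rewrite -expgM collapsed_Cn.
exact: collapsed_commYCn.
Qed.

(** All the generators of the right-hand side are centralised by C, X ^+ s and
    Y ^+ s, and contain their commutators; [X ^+ s, Y ^+ s] is computed modulo
    U, V and C ^+ (s * n), where [macdonald_commX_pow] applies. *)
Lemma collapsed_der1 X Y (C := [~ X, Y]) : collapsed X Y ->
  <<[set C; X ^+ s; Y ^+ s]>>^`(1) \subset
    <<[set X ^+ (s * n); Y ^+ (s * n); C ^+ (s * s)]>>.
Proof.
move=> H; have H' := collapsed_sym H.
set U := X ^+ (s * n); set V := Y ^+ (s * n); pose Q := <<[set U; V; C ^+ (s * s)]>>%G.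
suffices: <<[set C; X ^+ s; Y ^+ s]>>^`(1) \subset Q by [].
have CE : [~ Y, X] = C^-1 by rewrite invgR.
have [UQ VQ DQ] : [/\ U \in Q, V \in Q & C ^+ (s * s) \in Q].
  by split; apply: mem_gen; rewrite !inE ?eqxx ?orbT.
(* modulo Q2 the exponents e with s * n %| 2 * e become trivial *)
pose Q2 := <<[set U; V; C ^+ (s * n)]>>%G.
have [UQ2 VQ2 WQ2] : [/\ U \in Q2, V \in Q2 & C ^+ (s * n) \in Q2].
  by split; apply: mem_gen; rewrite !inE ?eqxx ?orbT.
have nQ2 : (X \in 'N(Q2)) && (Y \in 'N(Q2)).
  have cW : C ^+ (s * n) ^ X = C ^+ (s * n) /\ C ^+ (s * n) ^ Y = C ^+ (s * n).
    split; apply/conjg_fixP/commgP/commute_sym; first exact: collapsed_commXCn.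
    exact: collapsed_commYCn.
  apply/andP; split; apply: norm_gen1 => u; rewrite !inE -orbA.
    case/or3P=> /eqP ->; last by rewrite cW.1.
      by rewrite conjXg conjgE mulKg.
    by rewrite conjg_mulR (collapsed_commUY H') CE expgVn groupM ?groupV.
  case/or3P=> /eqP ->; last by rewrite cW.2.
    by rewrite conjg_mulR (collapsed_commUY H) groupM.
  by rewrite conjXg conjgE mulKg.
have [nXQ2 nYQ2] := andP nQ2.
have sQ2 : Q2 \subset Q.
  rewrite gen_subG; apply/subsetP=> u; rewrite !inE -orbA => /or3P[] /eqP -> //.
  by have [k ->] := dvdnP sn; rewrite mulnCA mulnC expgM groupX.
have XYQ : [~ X ^+ s, Y ^+ s] \in Q.
  have nCQ2 : C \in 'N(Q2) by rewrite groupR.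
  have Mc := macdonald_morph (coset_morphism Q2) nXQ2 nYQ2 (proj1 H).
  have E : coset Q2 [~ X ^+ s, Y ^+ s] = coset Q2 (C ^+ (s * s)).
    rewrite morphR ?groupX // !morphX // [in RHS]/C morphR //.
    apply: (macdonald_commX_pow sn Mc) => e de; rewrite -morphX //; apply: coset_id.
      by apply: subsetP (collapsed_exp_mem H de); rewrite cycle_subG.
    by apply: subsetP (collapsed_exp_mem H' de); rewrite cycle_subG.
  have : [~ X ^+ s, Y ^+ s] \in Q2 :* C ^+ (s * s).
    by apply/rcoset_kercosetP => //; rewrite ?groupR ?groupX.
  by rewrite mem_rcoset => /(subsetP sQ2); rewrite groupMr // groupV.
have cSQ : [set C; X ^+ s; Y ^+ s] \subset 'C([set U; V; C ^+ (s * s)]).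
  have cVC : commute V C.
    by have := collapsed_commUC H'; rewrite CE => /commuteV; rewrite invgK.
  have cYD : commute (Y ^+ s) (C ^+ (s * s)).
    by have := collapsed_commXsCss H'; rewrite CE expgVn => /commuteV; rewrite invgK.
  apply/centsP=> u Su v; move: Su; rewrite !inE -!orbA.
  case/or3P=> /eqP -> /or3P[] /eqP ->.
  - exact/commute_sym/collapsed_commUC.
  - exact: commute_sym.
  - exact: commuteX.
  - exact: commuteX2.
  - exact/commute_sym/collapsed_commUYs.
  - exact: collapsed_commXsCss.
  - exact/commute_sym/collapsed_commUYs.
  - exact: commuteX2.
  - exact: cYD.
have nSQ : [set C; X ^+ s; Y ^+ s] \subset 'N(Q).
  exact: subset_trans (cents_norm cSQ) (norm_gen _).
have XsC : [~ X ^+ s, C] \in Q by rewrite collapsed_commXsC.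
have YsC : [~ Y ^+ s, C] \in Q.
  have nCQ : C^-1 \in 'N(Q) by rewrite groupV (subsetP nSQ) // !inE eqxx.
  by rewrite -groupV -(memJ_norm _ nCQ) -commg_invr -CE collapsed_commXsC.
apply: der1_sub_gen => // u v; rewrite !inE -!orbA.
by do 2![case/or3P=> /eqP ->] => //; rewrite ?commgg ?group1 // -groupV invgR.
Qed.

End MacdonaldQuotient.

(** * The upper bound *)

Section UpperBound.

Variables (gT : finGroupType) (a g : nat).
Hypotheses (a_gt1 : 1 < a) (g_gt0 : 0 < g).
Implicit Types x y z : gT.

Local Notation m := (a ^ g)%N.
Local Notation n := (a ^ g).-1.
Local Notation s := a.-1.
Local Notation r := (gcdn 3 a.-1).

Let nK : n.+1 = m. Proof. by rewrite prednK // expn_gt0 ltnW. Qed.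
Let sn : s %| n. Proof. by rewrite predn_exp dvdn_mulr. Qed.
Let rs : r %| s. Proof. exact: dvdn_gcdr. Qed.
Let r3 : r %| 3. Proof. exact: dvdn_gcdl. Qed.

Lemma wamsley_central_power x y z e : wamsley a g x y z ->
  (r * s * n %| 2 * e)%N -> commute (x ^+ e) y.
Proof.
move=> Wr de; have M := wamsley_macdonald Wr.
have m0 : 0 < m by rewrite -nK.
have [d dP] := commute_exponents x y.
suff : (d %| e)%N by rewrite dP => /cent1P.
apply: (central_exponent a_gt1 g_gt0 (order_gt0 x)) de.
- by rewrite dP expg_order group1.
- exact: macdonald_order m0 M.
move=> j; rewrite dP; apply/cent1P; exact: (wamsley_commute (ltnW a_gt1) j Wr).
Qed.

Lemma wamsley_commXC x y z : wamsley a g x y z -> [~ x, [~ x, y]] = x ^+ n.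
Proof.
case/wamsley_macdonald=> xc _.
by rewrite commgEl xc -nK expgS mulKg.
Qed.

Lemma wamsley_norm_step x y z (K : {group gT}) : wamsley a g x y z ->
    [~ x, y] \in K -> x ^+ s \in K -> y ^+ s \in K ->
  [~ x, y] ^ x \in K /\ (y ^+ s) ^ x \in K.
Proof.
move=> Wr Kc Kx Ky; have M := wamsley_macdonald Wr; split.
  rewrite conjg_mulR -(invg_comm x) (wamsley_commXC Wr) groupM ?groupV //.
  by have [k ->] := dvdnP sn; rewrite mulnC expgM groupX.
rewrite (macdonald_expJ _ (macdonald_sym M)) groupM //.
  by rewrite groupX // -(invg_comm x) groupV.
have [k kE] := dvdnP (dvdn_geom sn (dvdnn s)).
by rewrite -nK kE mulnA mulnC expgM groupX.
Qed.

(** The three generators of the right-hand side are [x, y], [x, z] and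
    [y, z^-1], so it is enough that they generate a normal subgroup. *)
Lemma wamsley_der1 x y z : wamsley a g x y z ->
  <<[set x; y; z]>>^`(1) \subset <<[set [~ x, y]; x ^+ s; y ^+ s]>>.
Proof.
move=> Wr; have Wr' := wamsley_sym Wr; pose G1 := <<[set [~ x, y]; x ^+ s; y ^+ s]>>%G.
suffices: <<[set x; y; z]>>^`(1) \subset G1 by [].
have [Gc Gx Gy] : [/\ [~ x, y] \in G1, x ^+ s \in G1 & y ^+ s \in G1].
  by split; apply: mem_gen; rewrite !inE ?eqxx ?orbT.
have [xz yz zg] := Wr.
have Gc' : [~ y, x] \in G1 by rewrite -(invg_comm x) groupV.
have [cx yx] := wamsley_norm_step Wr Gc Gx Gy.
have [cy xy] := wamsley_norm_step Wr' Gc' Gy Gx.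
have Xz : [~ x, z] = x ^+ s.
  by rewrite commgEl xz -[X in _ ^+ X](prednK (ltnW a_gt1)) expgS mulKg.
have Yz : [~ y, z^-1] = y ^+ s.
  by rewrite commgEl yz -[X in _ ^+ X](prednK (ltnW a_gt1)) expgS mulKg.
have nz : z \in 'N(G1).
  apply: norm_gen1 => u; rewrite !inE -orbA => /or3P[] /eqP ->.
  - have cz : [~ x, y] ^ z = [~ x, y] by rewrite -zg conjXg conjgE mulKg.
    by rewrite cz.
  - by rewrite conjXg xz -expgM mulnC expgM groupX.
  have : z \in 'N(<[y ^+ s]>).
    by rewrite -groupV; apply: (@norm_cycle_expg _ _ _ a); rewrite conjXg yz -!expgM mulnC.
  move/memJ_norm=> E; apply: (subsetP (_ : <[y ^+ s]> \subset G1)).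
    by rewrite cycle_subG.
  by rewrite E cycle_id.
have nx : x \in 'N(G1).
  apply: norm_gen1 => u; rewrite !inE -orbA => /or3P[] /eqP -> //.
  by rewrite conjXg conjgE mulKg.
have ny : y \in 'N(G1).
  apply: norm_gen1 => u; rewrite !inE -orbA => /or3P[] /eqP -> //.
    by rewrite -groupV -conjVg invg_comm.
  by rewrite conjXg conjgE mulKg.
have Yz' : [~ y, z] \in G1.
  by rewrite -[z]invgK commg_invr invgK memJ_norm // groupV Yz.
apply: der1_sub_gen.
  by apply/subsetP=> u; rewrite !(in_setU, in_set1) -orbA => /or3P[] /eqP ->.
have Xz' : [~ x, z] \in G1 by rewrite Xz.
move=> u v; rewrite !inE -!orbA.
by do 2![case/or3P=> /eqP ->] => //; rewrite ?commgg ?group1 // -invg_comm groupV.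
Qed.

Lemma wamsley_commUD x y z : wamsley a g x y z ->
  commute (x ^+ (s * n)) ([~ x, y] ^+ (s * s)).
Proof.
move=> Wr; have M := wamsley_macdonald Wr; have [xc _] := M.
have m0 : 0 < m by rewrite -nK.
apply/commgP/conjg_fixP; rewrite conjXg (conjg_iter _ xc) -expgM geomE //.
rewrite addn1 mulSn expgD.
suff -> : x ^+ (n * geom m (s * s) * (s * n)) = 1 by rewrite mulg1.
rewrite -mulnA; apply: (macdonald_commute_expn m0 M).
apply: (wamsley_central_power Wr).
have rg : r %| geom m (s * s).
  by rewrite -nK dvdn_geom ?dvdn_mulr // (dvdn_trans rs).
by rewrite dvdn_mull // -mulnA dvdn_mul.
Qed.

(** With Z the centre of J, [collapsed_der1] places the second derived subgroup
    in Z * K. The generators of K commute: for x ^+ (s * n) and y ^+ (s * n),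
    the commutator [x ^+ (s * n), y ^+ s] is central, so its n-th power can be
    moved into x, where x ^+ (s * n * n) is central. *)
Lemma wamsley_der3 x y z : wamsley a g x y z -> <<[set x; y; z]>>^`(3) = 1.
Proof.
move=> Wr; have M := wamsley_macdonald Wr.
pose c := [~ x, y]; pose J := <<[set x; y]>>%G; pose Z := 'Z(J)%G.
pose G1 := <<[set c; x ^+ s; y ^+ s]>>%G.
pose K := <<[set x ^+ (s * n); y ^+ (s * n); c ^+ (s * s)]>>%G.
have [Jx Jy] : x \in J /\ y \in J by split; apply: mem_gen; rewrite !inE eqxx ?orbT.
have Jc : c \in J by rewrite groupR.
have nZJ : J \subset 'N(Z) by rewrite gFnorm.
have [nx ny] : x \in 'N(Z) /\ y \in 'N(Z) by split; apply: (subsetP nZJ).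
have memZ u : u \in J -> commute u x -> commute u y -> u \in Z.
  move=> Ju ux uy; apply/centerP; split=> // v Jv.
  apply/cent1P; rewrite cent1C; apply/subsetP: v Jv; rewrite gen_subG.
  by apply/subsetP=> v; rewrite in_set2 => /orP[] /eqP ->; apply/cent1P.
have Zx e : r * s * n %| 2 * e -> x ^+ e \in Z.
  move=> de; apply: memZ; [exact: groupX | exact/commute_sym/commuteX |].
  exact: wamsley_central_power Wr de.
have Zy e : r * s * n %| 2 * e -> y ^+ e \in Z.
  move=> de; apply: memZ; [exact: groupX | | exact/commute_sym/commuteX].
  exact: wamsley_central_power (wamsley_sym Wr) de.
have Col : collapsed n r s (coset Z x) (coset Z y).
  split; first by rewrite nK; apply: (macdonald_morph (coset_morphism Z)).
  by move=> e de; rewrite -!morphX //; split; apply: coset_id; [apply: Zx | apply: Zy].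
have sG1J : G1 \subset J.
  by rewrite gen_subG; apply/subsetP=> u; rewrite !inE -orbA => /or3P[] /eqP ->; rewrite ?groupX.
have sKJ : K \subset J.
  by rewrite gen_subG; apply/subsetP=> u; rewrite !inE -orbA => /or3P[] /eqP ->; rewrite ?groupX.
have G1' : G1^`(1) \subset Z * K.
  have nG1 : G1 \subset 'N(Z) := subset_trans sG1J nZJ.
  rewrite -quotientSK ?(subset_trans (der_sub 1 G1)) // (quotient_der 1 nG1).
  have im3 (u v w : gT) : u \in 'N(Z) -> v \in 'N(Z) -> w \in 'N(Z) ->
      <<[set u; v; w]>> / Z = <<[set coset Z u; coset Z v; coset Z w]>>.
    move=> nu nv nw; rewrite quotient_gen; last first.
      by apply/subsetP=> t; rewrite !(in_setU, in_set1) -orbA => /or3P[] /eqP ->.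
    by rewrite /quotient !morphimU !morphim_set1.
  have nc : c \in 'N(Z) by rewrite groupR.
  rewrite !im3 ?groupX // !morphX // /c !morphR //.
  exact: (collapsed_der1 r3 rs sn Col).
have cUY : [~ x ^+ (s * n), y ^+ s] \in Z.
  have := collapsed_commUYs r3 rs sn Col; rewrite -!morphX // => /commgP/eqP.
  rewrite -morphR ?groupX // => /coset_idr; apply; first by rewrite groupR ?groupX.
have cZ u v : u \in Z -> v \in J -> commute u v.
  by case/setIP=> _ /centP; apply.
have abK : abelian K.
  rewrite abelian_gen.
  have cUV : commute (x ^+ (s * n)) (y ^+ (s * n)).
    apply/commgP; rewrite [in y ^+ _]expgM commgX; last first.
      by apply/commute_sym/cZ; rewrite ?groupX.
    rewrite -commXg; last by apply/commute_sym/cZ; rewrite ?groupX.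
    apply/commgP/commuteX; rewrite -expgM; apply: (wamsley_central_power Wr).
    by rewrite dvdn_mull // dvdn_mul // mulnC dvdn_mul // (dvdn_trans rs).
  have cUD := wamsley_commUD Wr; have := wamsley_commUD (wamsley_sym Wr).
  rewrite -invg_comm expgVn => /commuteV; rewrite invgK => cVD.
  apply/centsP=> u Su v; move: Su; rewrite !inE -!orbA.
  by case/or3P=> /eqP -> /or3P[] /eqP ->.
have abZK : abelian (Z * K).
  rewrite abelianM abK center_abelian /=.
  by rewrite centsC (subset_trans (subsetIr _ _)) // centS.
have G1'' : G1^`(2) = 1.
  apply/trivgP; apply: subset_trans (commgSS G1' G1') _.
  by rewrite (commG1P abZK).
apply/trivgP; rewrite -G1''; have s1 := wamsley_der1 Wr.
by have s2 := commgSS s1 s1; apply: (commgSS s2 s2).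
Qed.

Lemma wamsley_der2 x y z : wamsley a g x y z ->
  commute (x ^+ s) y -> commute (y ^+ s) x -> <<[set x; y; z]>>^`(2) = 1.
Proof.
move=> Wr xy yx; apply/trivgP; have s1 := wamsley_der1 Wr.
apply: subset_trans (commgSS s1 s1) _.
suff /commG1P-> : abelian <<[set [~ x, y]; x ^+ s; y ^+ s]>> by [].
rewrite abelian_gen.
have xc : commute (x ^+ s) [~ x, y].
  by apply/cent1P; rewrite cent1C groupR //; apply/cent1P; [apply: commuteX | apply: commute_sym].
have yc : commute (y ^+ s) [~ x, y].
  by apply/cent1P; rewrite cent1C groupR //; apply/cent1P; [apply: commute_sym | apply: commuteX].
have xys : commute (x ^+ s) (y ^+ s) by apply: commuteX.
apply/centsP=> u Su v; move: Su; rewrite !inE -!orbA.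
by case/or3P=> /eqP -> /or3P[] /eqP ->.
Qed.

End UpperBound.

Lemma dvdn_succ_expn_odd a g : odd g -> (a.+1 %| (a ^ g).+1)%N.
Proof.
move=> og; have [->|a0] := posnP a; first exact: dvd1n.
rewrite -[g]odd_double_half og.
elim: (g./2) => [|k IH]; first by rewrite addn0 expn1.
have E : ((a ^ (true + k.+1.*2)).+1 + (a ^ 2 - 1) = a ^ 2 * (a ^ (true + k.*2)).+1)%N.
  have -> : (true + k.+1.*2 = 2 + (true + k.*2))%N by rewrite doubleS !addnS.
  by rewrite expnD; move: (expn a (true + _)) => b; nia.
rewrite -(@dvdn_addl (a ^ 2 - 1)) ?E ?dvdn_mull //.
by rewrite -(exp1n 2) subn_sqr addn1 dvdn_mull.
Qed.

(** Here (12 K).-1 stands for -1 modulo the order of x. Modulo K the number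
    e = s n / 2 of [wamsley_central_power] is then (-1) (-2) = 2, and the factor
    12 makes s prime to 3. *)
Lemma wamsley_square_commute (gT : finGroupType) K g (x y z : gT) :
    0 < K -> odd g -> x ^+ K = 1 -> wamsley (12 * K).-1 g x y z ->
  commute (x ^+ (12 * K).-2) y.
Proof.
move=> K0 og xK Wr; set a := (12 * K).-1 in Wr *.
have a1 : 1 < a by rewrite /a; lia.
have g0 : 0 < g by case: g og {Wr}.
have r1 : gcdn 3 a.-1 = 1%N.
  by apply/eqP; rewrite -/(coprime 3 a.-1) prime_coprime // /a; lia.
have [t tE] : exists t, (a ^ g).-1.+2 = (12 * K * t)%N.
  have /dvdnP[t tE] := dvdn_succ_expn_odd a og; exists t.
  have aK : a.+1 = (12 * K)%N by rewrite prednK // muln_gt0.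
  by rewrite mulnC -aK -tE prednK // expn_gt0 ltnW.
have t0 : 0 < t by case: t tE => //; rewrite muln0.
pose e := ((6 * K).-1 * (a ^ g).-1)%N.
have xe : commute (x ^+ e) y.
  apply: (wamsley_central_power a1 g0 Wr); rewrite r1 mul1n /e mulnA dvdn_mul //.
  by rewrite (_ : a.-1 = 2 * (6 * K).-1)%N // /a; lia.
have xE : x ^+ e = x ^+ 2.
  have eE : (e + K * (12 * t + 12) = 2 + K * (72 * K * t))%N.
    rewrite /e; move: tE; move: (a ^ g).-1 => n nE.
    have [q qE] : exists q, (6 * K = q.+1)%N by exists (6 * K).-1; lia.
    rewrite qE /=; have : (q * n.+2 = q * (12 * K * t))%N by rewrite nE.
    have -> : (72 * K * t = 12 * (6 * K) * t)%N by ring.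
    by rewrite qE; nia.
  apply: (mulIg (x ^+ (K * (12 * t + 12)))); rewrite -expgD eE expgD.
  by rewrite !(expgM _ K) xK !expg1n.
change (commute (x ^+ a.-1) y).
have -> : x ^+ a.-1 = (x ^+ 2)^-1.
  apply: (mulIg (x ^+ 2)); rewrite mulVg -expgD.
  have -> : (a.-1 + 2 = K * 12)%N by rewrite /a; lia.
  by rewrite expgM xK expg1n.
by apply/commute_sym/commuteV/commute_sym; rewrite -xE.
Qed.

(** * The presentation *)

Definition expgz (gT : finGroupType) (u : gT) (alpha : int) : gT :=
  match alpha with Posz n => u ^+ n | Negz n => (u ^+ n.+1)^-1 end.

Lemma expgz_mod (gT : finGroupType) (u : gT) (alpha : int) (a L : nat) :
  u ^+ L = 1 -> (L%:Z %| (a%:Z - alpha)%R)%Z -> expgz u alpha = u ^+ a.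
Proof.
move=> uL; have oL : (#[u] %| L)%N by rewrite order_dvdn uL.
case: alpha => n /=.
  rewrite -eqz_mod_dvd !modz_nat eqz_nat => /eqP E.
  by apply/esym/eqP; rewrite eq_expg_mod_order; apply/eqP; rewrite -(modn_dvdm a oL) E modn_dvdm.
rewrite NegzE GRing.opprK -PoszD dvdzE /= => Lan.
apply/esym/(mulIg (u ^+ n.+1)); rewrite mulVg -expgD.
by apply/eqP; rewrite -order_dvdn (dvdn_trans oL).
Qed.

Lemma wamsley_homGrp (gT : finGroupType) (G : {group gT}) (alpha : int) (g : nat) :
  reflect (exists x y z, [/\ G :=: <<[set x; y; z]>>, x ^ z = expgz x alpha,
             y ^ z^-1 = expgz y alpha & z ^+ g = [~ x, y]])
    (G \homg Grp (X : Y : Z :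
     X ^ Z = X ^~ alpha, Z * Y * Z^-1 = Y ^~ alpha, Z ^+ g = [~ X, Y])).
Proof.
have evalE e t :
  Presentation.eval e (pres_expz t alpha) = expgz (Presentation.eval e t : gT) alpha.
  by case: alpha.
have genE (x y z : gT) : <[x]> <*> <[y]> <*> <[z]> = <<[set x; y; z]>>.
  by rewrite /cycle !(joing_idl, joing_idr).
apply: (iffP existsP) => [[[[x y] z]] | [x [y [z [GE xz yz zg]]]]] /=.
  rewrite !evalE /= => /eqP[] GE xz yz zg.
  exists x, y, z; split=> //; first by rewrite -GE genE.
  by rewrite conjgE invgK mulgA.
exists (x, y, z); rewrite !evalE /= genE -GE xz zg.
by rewrite conjgE invgK mulgA in yz; rewrite yz.
Qed.

Lemma homg_der_trivial (gT rT : finGroupType) (G : {group gT}) (H : {group rT}) k :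
  H \homg G -> G^`(k) = 1 -> H^`(k) = 1.
Proof. by case/homgP=> f <- G1; rewrite -morphim_der // G1 morphim1. Qed.

(** W' contains [x, z] = x ^+ a.-1, [y, z^-1] = y ^+ a.-1 and [x, y]. *)
Lemma wamsley_der2_neq1 (gT : finGroupType) (a g : nat) (x y z : gT) :
    0 < a -> wamsley a g x y z ->
    (x ^+ (a.-1 * (a ^ g).-1) != 1) || ([~ x ^+ a.-1, y ^+ a.-1] != 1) ->
  <<[set x; y; z]>>^`(2) != 1.
Proof.
move=> a0 Wr; pose W := <<[set x; y; z]>>%G; rewrite -[<<_>>]/(gval W).
have [Wx Wy Wz] : [/\ x \in W, y \in W & z \in W].
  by split; apply: mem_gen; rewrite !inE eqxx ?orbT.
have [xz yz zg] := Wr; have [xc _] := wamsley_macdonald Wr.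
have W1x : x ^+ a.-1 \in W^`(1).
  suff <- : [~ x, z] = x ^+ a.-1 by rewrite mem_commg.
  by rewrite commgEl xz -[X in x ^+ X](prednK a0) expgS mulKg.
have W1y : y ^+ a.-1 \in W^`(1).
  suff <- : [~ y, z^-1] = y ^+ a.-1 by rewrite mem_commg ?groupV.
  by rewrite commgEl yz -[X in y ^+ X](prednK a0) expgS mulKg.
have W1c : [~ x, y] \in W^`(1) by rewrite mem_commg.
apply: contraL => /eqP W2; rewrite negb_or !negbK.
have W21 u v : u \in W^`(1) -> v \in W^`(1) -> [~ u, v] == 1.
  by move=> Wu Wv; apply/eqP/set1gP; rewrite -[1]W2 mem_commg.
rewrite (W21 _ _ W1x W1y) andbT.
suff <- : [~ x ^+ a.-1, [~ x, y]] = x ^+ (a.-1 * (a ^ g).-1) by apply: W21.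
have m0 : 0 < a ^ g by rewrite expn_gt0 a0.
rewrite commgEl conjXg xc -expgM -[X in (X * _)%N](prednK m0) mulSn expgD mulKg.
by rewrite mulnC.
Qed.

(** * Permutations induced by maps of a quotient set *)

Section PermOfMap.

Variables (V : Type) (T : finType) (pi : V -> T) (sec : T -> V).
Hypothesis secK : cancel sec pi.

Lemma perm_of_map (f : V -> V) :
    (forall v w, pi v = pi w -> pi (f v) = pi (f w)) ->
    (forall w, exists v, pi (f v) = pi w) ->
  exists p : {perm T}, forall v, p (pi v) = pi (f v).
Proof.
move=> fE f_onto; pose F t := pi (f (sec t)).
have F_onto t : exists u, F u == t.
  have [v vE] := f_onto (sec t); exists (pi v).
  by rewrite /F -[t]secK -vE; apply/eqP/fE; rewrite secK.
pose G t := xchoose (F_onto t).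
have GK : cancel G F by move=> t; apply/eqP/(xchooseP (F_onto t)).
have [G' GK' KG'] := injF_bij (can_inj GK).
have F_inj : injective F.
  by move=> u v; rewrite -(KG' u) -(KG' v) !GK => ->.
by exists (perm F_inj) => v; rewrite permE; apply: fE; rewrite secK.
Qed.

Lemma eq_perm_pi (p q : {perm T}) : (forall v, p (pi v) = q (pi v)) -> p = q.
Proof. by move=> E; apply/permP=> t; rewrite -(secK t). Qed.

End PermOfMap.

(** Residues as elements of a finite type, for M > 0. *)
Definition zres (M : nat) (a : int) : 'I_M.-1.+1 := inord `|(a %% M)%Z|.

Lemma zres_eq M a b : 0 < M -> (zres M a = zres M b) <-> (M%:Z %| (a - b)%R)%Z.
Proof.
move=> M0; have Mz : Posz M != 0%R by rewrite eqz_nat -lt0n.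
have lt c : `|(c %% M)%Z| < M.-1.+1.
  by rewrite prednK // -ltz_nat gez0_abs ?modz_ge0 // ltz_pmod.
rewrite -eqz_mod_dvd; split=> [/(congr1 val)|/eqP E]; last by rewrite /zres E.
rewrite /= !inordK // => E; apply/eqP.
by rewrite -[LHS]gez0_abs ?modz_ge0 // E gez0_abs ?modz_ge0.
Qed.

Lemma zresK M : 0 < M -> cancel (fun i : 'I_M.-1.+1 => Posz (val i)) (zres M).
Proof.
move=> M0 i; apply: val_inj; rewrite /= /zres modz_small ?inordK //=.
by rewrite ltz_nat -[X in _ < X](prednK M0) ltn_ord.
Qed.

Import GRing.Theory Num.Theory.

Lemma dvdz_lin (d e1 e2 k1 k2 e : int) : (d %| e1)%Z -> (d %| e2)%Z ->
  (e = e1 * k1 + e2 * k2)%R -> (d %| e)%Z.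
Proof. by move=> d1 d2 ->; rewrite rpredD // dvdz_mulr. Qed.

Lemma PoszX (a k : nat) : (Posz (a ^ k)%N = Posz a ^+ k)%R.
Proof. by elim: k => // k IH; rewrite expnS exprS PoszM IH. Qed.

(** * Extensions of Heisenberg groups *)

Section Heisenberg.

Variables (a g M : nat).
Hypotheses (g_gt0 : 0 < g) (M_gt0 : 0 < M) (ag1 : a ^ g = 1 %[mod M]).

Local Open Scope ring_scope.
Local Notation A := (Posz a).
Local Notation B := (A ^+ g.-1).
Local Notation V := (int * int * int)%type.

Let T : finType := 'I_M.-1.+1 * 'I_M.-1.+1 * 'I_(g * M).-1.+1 : Type.
Let pi (v : V) : T := (zres M v.1.1, zres M v.1.2, zres (g * M) v.2).
Let sec (t : T) : V := (Posz (val t.1.1), Posz (val t.1.2), Posz (val t.2)).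

Let gM_gt0 : (0 < g * M)%N. Proof. by rewrite muln_gt0 g_gt0. Qed.

Let secK : cancel sec pi.
Proof. by case=> [[i j] k]; rewrite /pi /= !zresK. Qed.

Let piP v w : pi v = pi w <->
  [/\ (Posz M %| v.1.1 - w.1.1)%Z, (Posz M %| v.1.2 - w.1.2)%Z
    & (Posz (g * M) %| v.2 - w.2)%Z].
Proof.
split=> [[/(zres_eq _ _ M_gt0) ? /(zres_eq _ _ M_gt0) ? /(zres_eq _ _ gM_gt0) ?] //|].
by case=> *; rewrite /pi; congr (_, _, _); apply/zres_eq.
Qed.

Let Ag : (Posz M %| A ^+ g - 1)%Z.
Proof. by rewrite -PoszX -eqz_mod_dvd !modz_nat ag1. Qed.

Let AB : A ^+ g = A * B. Proof. by rewrite -exprS prednK. Qed.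

Let fx (v : V) : V := (v.1.1 - 1, v.1.2, v.2).
Let fy (v : V) : V := (v.1.1, v.1.2 - 1, v.2 + g%:Z * v.1.1).
Let fz (v : V) : V := (A * v.1.1, B * v.1.2, v.2 - 1).

(** A group element g acts on the right through left multiplication by its
    inverse. The triple (u, v, w) is the element X^u Y^v Z^w, with u and v taken
    modulo M, and w modulo g * M because Z^(g * M) = C^M = 1. *)
Lemma heisenberg_model : exists (T : finType) (x y z : {perm T}),
  [/\ wamsley a g x y z, (x ^+ M)%g = 1%g, (y ^+ M)%g = 1%g,
      commute x [~ x, y]%g /\ commute y [~ x, y]%g
    & forall k, ([~ x, y] ^+ k)%g = 1%g -> (M %| k)%N].
Proof.
have dg d : (Posz M %| d)%Z -> (Posz (g * M) %| g%:Z * d)%Z.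
  by move=> Md; rewrite PoszM dvdz_mul.
have d0 : (Posz M %| 0)%Z by apply: dvdz0.
have [x xE] : exists x : {perm T}, forall v, x (pi v) = pi (fx v).
  apply: (perm_of_map secK) => [v w /piP[d1 d2 d3]|[[u v] w]].
    by apply/piP; split=> //=; rewrite opprD addrACA subrr addr0.
  by exists (u + 1, v, w); rewrite /fx /= addrK.
have [y yE] : exists y : {perm T}, forall v, y (pi v) = pi (fy v).
  apply: (perm_of_map secK) => [v w /piP[d1 d2 d3]|[[u v] w]].
    apply/piP; split=> //=; first by rewrite opprD addrACA subrr addr0.
    by apply: (dvdz_lin (k1 := 1) (k2 := 1) d3 (dg _ d1)); ring.
  by exists (u, v + 1, w - g%:Z * u); rewrite /fy /= addrK subrK.
have [z zE] : exists z : {perm T}, forall v, z (pi v) = pi (fz v).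
  apply: (perm_of_map secK) => [v w /piP[d1 d2 d3]|[[u v] w]].
    apply/piP; split=> /=; rewrite -?mulrBr ?dvdz_mull //.
    by rewrite opprD addrACA subrr addr0.
  exists (B * u, A * v, w + 1); apply/piP; split=> /=; rewrite ?addrK ?subrr ?dvdz0 //.
    by apply: (dvdz_lin (k1 := u) (k2 := 0) Ag d0); rewrite AB; ring.
  by apply: (dvdz_lin (k1 := v) (k2 := 0) Ag d0); rewrite AB; ring.
have xX k v : (x ^+ k)%g (pi v) = pi (v.1.1 - k%:Z, v.1.2, v.2).
  elim: k => [|k IH]; first by rewrite perm1 subr0; case: v => [[]].
  by rewrite expgSr permM IH xE /fx /= -addrA -opprD -[1]/(Posz 1) -PoszD addn1.
have yX k v : (y ^+ k)%g (pi v) = pi (v.1.1, v.1.2 - k%:Z, v.2 + k%:Z * (g%:Z * v.1.1)).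
  elim: k => [|k IH]; first by rewrite perm1 subr0 mul0r addr0; case: v => [[]].
  rewrite expgSr permM IH yE /fy /= intS; congr (pi (_, _, _)); ring.
have zX k v : (z ^+ k)%g (pi v) = pi (A ^+ k * v.1.1, B ^+ k * v.1.2, v.2 - k%:Z).
  elim: k => [|k IH]; first by rewrite perm1 !expr0 !mul1r subr0; case: v => [[]].
  rewrite expgSr permM IH zE /fz /= !exprS intS; congr (pi (_, _, _)); ring.
have Bg : (Posz M %| B ^+ g - 1)%Z.
  by rewrite exprAC subrX1 dvdz_mulr.
have zg : (z ^+ g)%g = [~ x, y]%g.
  apply: (mulgI (y * x)%g); rewrite -commgC.
  apply: (eq_perm_pi secK) => v; rewrite !permM yE xE xE yE zX; apply/piP; split=> /=.
  - by apply: (dvdz_lin (k1 := v.1.1 - 1) (k2 := 0) Ag d0); ring.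
  - by apply: (dvdz_lin (k1 := v.1.2 - 1) (k2 := 0) Bg d0); ring.
  by rewrite (_ : _ - _ = 0) ?dvdz0 //; ring.
have cX v k : ([~ x, y] ^+ k)%g (pi v) = pi (v.1.1, v.1.2, v.2 - g%:Z * k%:Z).
  rewrite -zg -expgM zX; apply/piP; split=> /=.
  - have Agk : (Posz M %| A ^+ (g * k) - 1)%Z by rewrite exprM subrX1 dvdz_mulr.
    by apply: (dvdz_lin (k1 := v.1.1) (k2 := 0) Agk d0); ring.
  - have Bgk : (Posz M %| B ^+ (g * k) - 1)%Z.
      by rewrite (exprM B) subrX1 dvdz_mulr.
    by apply: (dvdz_lin (k1 := v.1.2) (k2 := 0) Bgk d0); ring.
  by rewrite PoszM subrr dvdz0.
have cE v : [~ x, y]%g (pi v) = pi (v.1.1, v.1.2, v.2 - g%:Z).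
  by have := cX v 1%N; rewrite expg1 mulr1.
have dM : (Posz M %| - Posz M)%Z by rewrite rpredN dvdzz.
exists T, x, y, z; split.
- split=> //.
    apply: (mulgI z); rewrite conjgE mulKVg.
    apply: (eq_perm_pi secK) => v; rewrite !permM xE zE zE xX /fx /fz /=.
    by congr (pi (_, _, _)); ring.
  apply: (mulIg z); rewrite conjgE invgK !mulgA mulgKV.
  apply: (eq_perm_pi secK) => v; rewrite !permM zE yE yX zE /fy /fz /=.
  apply/piP; split=> /=; [by rewrite subrr dvdz0 | | ].
    by apply: (dvdz_lin (k1 := 1) (k2 := 0) Ag d0); rewrite AB; ring.
  by rewrite (_ : _ - _ = 0) ?dvdz0 //; ring.
- apply: (eq_perm_pi secK) => v; rewrite xX perm1; apply/piP; split=> /=.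
  + by rewrite addrAC subrr add0r.
  + by rewrite subrr.
  by rewrite subrr dvdz0.
- apply: (eq_perm_pi secK) => v; rewrite yX perm1; apply/piP; split=> /=.
  + by rewrite subrr.
  + by rewrite addrAC subrr add0r.
  by rewrite addrAC subrr add0r mulrCA PoszM mulrA dvdz_mulr.
- move: [~ x, y]%g cE => c cE.
  split; apply: (eq_perm_pi secK) => v; rewrite !permM cE !(xE, yE) cE /fx /fy /=.
    by congr (pi (_, _, _)).
  by congr (pi (_, _, _)); ring.
move=> k ck; have := cX (0, 0, 0) k; rewrite ck perm1 => /piP[_ _].
rewrite [X in (_ %| X)%Z](_ : _ = g%:Z * k%:Z); last by rewrite /snd; ring.
by rewrite -PoszM dvdzE !absz_nat dvdn_pmul2l.
Qed.

End Heisenberg.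

(** * Truncated exponentials *)

Section TruncatedExponentials.

Local Open Scope ring_scope.

Variable h : int.

Lemma binomial2_int (k : int) : exists t : int, k * (k - 1) = 2 * t.
Proof.
have [u [->|->]] : exists u : int, k = 2 * u \/ k = 2 * u + 1.
- by exists (k %/ 2)%Z; lia.
- by exists (u * (2 * u - 1)); ring.
by exists (u * (2 * u + 1)); ring.
Qed.

(** With m = 1 + 12 h and 144 h^3 = 0, [texp] is the power m^a and [tgeom] is the
    sum of m^-i for i < a. The factor 12 absorbs the denominators of the
    binomial coefficients. *)
Definition texp (a : int) : int :=
  1 + 12 * h * a + 72 * h ^+ 2 * (a * (a - 1)).

Definition tgeom (a : int) : int :=
  a - (6 * h - 72 * h ^+ 2) * (a * (a - 1)) + 24 * h ^+ 2 * (a * (a - 1)) * (a - 2).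

(** The j-th iterate of (a, b) |-> (tgeom a, texp a * (b - 1)) is
    (flowA j a, flowP j a * b - flowS j a) up to multiples of 144 h^3, as the
    lemmas on the successive steps show. These formulas make sense for negative
    j too. *)
Definition flowA (j a : int) : int :=
  a - (6 * h - 72 * h ^+ 2) * j * (a * (a - 1))
    + 24 * h ^+ 2 * j * (a * (a - 1)) * (a - 2)
    + 18 * h ^+ 2 * (j * (j - 1)) * (a * (a - 1)) * (2 * a - 1).

Definition flowP (j a : int) : int :=
  1 + 12 * h * j * a - 36 * h ^+ 2 * (a * (a - 1)) * (j * (j - 1))
    + 72 * h ^+ 2 * a ^+ 2 * (j * (j - 1)) + 72 * h ^+ 2 * j * (a * (a - 1)).

Definition flowS (j a : int) : int :=
  j + 6 * h * a * (j * (j - 1)) + 12 * h * a * j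
    + 24 * h ^+ 2 * a * (j * (j - 1)) * (j + 1)
    + 36 * h ^+ 2 * (j * (j - 1)) * (a * (a - 1)) + 72 * h ^+ 2 * j * (a * (a - 1)).

Lemma flowA_step j a : exists K, tgeom (flowA j a) - flowA (j + 1) a = 144 * h ^+ 3 * K.
Proof.
have [t tE] := binomial2_int a; have [v vE] := binomial2_int j.
pose D := - (1 - 12 * h) * j * t + 4 * h * j * t * (a - 2) + 6 * h * v * t * (2 * a - 1).
have vE' : (j + 1) * (j + 1 - 1) = 2 * (v + j) by rewrite [RHS]mulrDr -vE; ring.
have AE : flowA j a = a + 12 * h * D by rewrite /flowA tE vE /D; ring.
have AE' : flowA (j + 1) a = a + 12 * h * (- (1 - 12 * h) * (j + 1) * t
    + 4 * h * (j + 1) * t * (a - 2) + 6 * h * (v + j) * t * (2 * a - 1)).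
  by rewrite /flowA vE' tE; ring.
rewrite /tgeom AE'.
have -> : flowA j a * (flowA j a - 1) = 2 * t + 12 * h * D * (2 * a - 1) + 144 * h ^+ 2 * D ^+ 2.
  by rewrite -tE AE; ring.
rewrite AE; exists (- (6 * j * t + 2 * j * t * (a - 2) + 3 * v * t * (2 * a - 1)) * (2 * a - 1)
  + 6 * D * (2 * a - 1) - 6 * (1 - 12 * h) * D ^+ 2 + 4 * t * D
  + 2 * (D * (2 * a - 1) + 12 * h * D ^+ 2) * (a - 2 + 12 * h * D)).
rewrite /D; ring.
Qed.

Lemma flowE_step j a : exists K, texp (flowA j a) =
  1 + 12 * h * a - 72 * h ^+ 2 * (a * (a - 1)) * (j - 1) + 144 * h ^+ 3 * K.
Proof.
have [t tE] := binomial2_int a; have [v vE] := binomial2_int j.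
pose D := - (1 - 12 * h) * j * t + 4 * h * j * t * (a - 2) + 6 * h * v * t * (2 * a - 1).
have AE : flowA j a = a + 12 * h * D by rewrite /flowA tE vE /D; ring.
rewrite /texp.
have -> : flowA j a * (flowA j a - 1) = 2 * t + 12 * h * D * (2 * a - 1) + 144 * h ^+ 2 * D ^+ 2.
  by rewrite -tE AE; ring.
rewrite AE tE; exists (12 * j * t + 4 * j * t * (a - 2) + 6 * v * t * (2 * a - 1)
  + 6 * D * (2 * a - 1) + 72 * h * D ^+ 2).
rewrite /D; ring.
Qed.

Lemma flowP_step j a : exists K,
  texp (flowA j a) * flowP j a - flowP (j + 1) a = 144 * h ^+ 3 * K.
Proof.
have [t tE] := binomial2_int a; have [v vE] := binomial2_int j.
have vE' : (j + 1) * (j + 1 - 1) = 2 * (v + j) by rewrite [RHS]mulrDr -vE; ring.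
have [K0 ->] := flowE_step j a; rewrite /flowP vE' vE tE.
pose Q := - t * v + a ^+ 2 * v + j * t.
exists (K0 * (1 + 12 * h * j * a + 144 * h ^+ 2 * Q) + 12 * a * Q + 12 * j * a * t * (1 - j)
  + 144 * h * t * (1 - j) * Q).
rewrite /Q; ring.
Qed.

Lemma flowS_step j a : exists K,
  texp (flowA j a) * (flowS j a + 1) - flowS (j + 1) a = 144 * h ^+ 3 * K.
Proof.
have [t tE] := binomial2_int a; have [v vE] := binomial2_int j.
have vE' : (j + 1) * (j + 1 - 1) = 2 * (v + j) by rewrite [RHS]mulrDr -vE; ring.
have [K0 ->] := flowE_step j a; rewrite /flowS vE' vE tE.
pose S := j + 12 * h * a * (v + j) + 48 * h ^+ 2 * a * v * (j + 1)
  + 144 * h ^+ 2 * (v + j) * t.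
exists (K0 * (S + 1) + 4 * a ^+ 2 * v * (j + 1) + 12 * a * (v + j) * t
  + 12 * a * t * (1 - j) * (v + j)
  + h * t * (1 - j) * (48 * a * v * (j + 1) + 144 * (v + j) * t)).
have X : a * (a - 1) - 2 * t = 0 by rewrite tE subrr.
have Y : j * (j - 1) - 2 * v = 0 by rewrite vE subrr.
apply/eqP; rewrite -subr_eq0; apply/eqP.
transitivity (144 * h ^+ 2 * (v + j) * (a * (a - 1) - 2 * t)
  - h ^+ 2 * (48 * a + 144 * t) * (j * (j - 1) - 2 * v)); first by rewrite /S; ring.
by rewrite X Y !mulr0 subrr.
Qed.

(** The relation Z Y Z^-1 = Y^m compares the m-th iterate with the effect of the
    dilation (a, b) |-> (m a, b / m). Both coordinates are off by the same
    quantity -72 h^2 u: this is why a lattice containing diagonal vectors (q, q)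
    is factored out. *)
Lemma flow_scaleA (a := 1 + 12 * h) u : exists K,
  tgeom (a * u) - a * flowA a u = - 72 * h ^+ 2 * u + 144 * h ^+ 3 * K.
Proof.
have [t tE] := binomial2_int u.
have aE : a * (a - 1) = 12 * h * a by rewrite /a; ring.
rewrite /flowA aE tE /tgeom.
have -> : a * u * (a * u - 1) = 2 * t + 12 * h * u * (2 * u - 1) + 144 * h ^+ 2 * u ^+ 2.
  by rewrite -tE /a; ring.
exists (- 192 * u * h * t - 864 * u * h ^+ 2 * t - 10 * u * t - 2 * u - 4 * u ^+ 2
  + 72 * u ^+ 3 * h + 288 * u ^+ 3 * h ^+ 2 + 4 * u ^+ 3 + 24 * h * t
  + 432 * h ^+ 2 * t + 7 * t).
apply/eqP; rewrite -subr_eq0; apply/eqP.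
transitivity (- 144 * h ^+ 2 * (u * (u - 1) - 2 * t)); first by rewrite /a; ring.
by rewrite tE subrr mulr0.
Qed.

Lemma flow_scaleB (a := 1 + 12 * h) (b := 1 - 12 * h + 144 * h ^+ 2) u w : exists K,
  texp (a * u) * (b * w - 1) - b * (flowP a u * w - flowS a u) =
    - 72 * h ^+ 2 * u + 144 * h ^+ 3 * K.
Proof.
have [t tE] := binomial2_int u.
have aE : a * (a - 1) = 12 * h * a by rewrite /a; ring.
rewrite /flowP /flowS aE tE /texp.
have -> : a * u * (a * u - 1) = 2 * t + 12 * h * u * (2 * u - 1) + 144 * h ^+ 2 * u ^+ 2.
  by rewrite -tE /a; ring.
pose K0 := 6 * u * (2 * u - 1) + 72 * h * u ^+ 2.
pose KP := 6 * a * (u ^+ 2 - t) + 12 * t.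
pose KS := 6 * u + 2 * u * a * (a + 1) + 6 * a * t + 12 * t.
exists (b * w * (K0 - KP) - K0 + b * KS + (12 - 6 * u - 12 * t)
  + h * (216 * u + 144 * t)).
rewrite /K0 /KP /KS /a /b; ring.
Qed.

End TruncatedExponentials.

(** Pairs are considered modulo the lattice generated by (N, 0) and (q, q), where
    q is chosen so that N divides 6 h q; this makes the maps below compatible
    with the lattice. Since (144 h^2, 0) is not in the lattice, x ^+ (144 h^2) is nontrivial. *)
Section TruncatedModel.

Variables (h N : nat).
Hypotheses (N_gt0 : 0 < N) (Nh3 : N %| 144 * h ^ 3) (Nh2 : ~~ (N %| 144 * h ^ 2)).

Local Open Scope ring_scope.
Local Notation H := (Posz h).
Local Notation q := (N %/ gcdn N (6 * h))%N.
Local Notation A := (1 + 12 * H).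
Local Notation B := (1 - 12 * H + 144 * H ^+ 2).
Local Notation V := (int * int)%type.

Let T : finType := 'I_N.-1.+1 * 'I_q.-1.+1 : Type.
Let pi (v : V) : T := (zres N (v.1 - v.2), zres q v.2).
Let sec (t : T) : V := (Posz (val t.1) + Posz (val t.2), Posz (val t.2)).

Let G_gt0 : (0 < gcdn N (6 * h))%N. Proof. by rewrite gcdn_gt0 N_gt0. Qed.
Let qG : (q * gcdn N (6 * h))%N = N. Proof. by rewrite divnK // dvdn_gcdl. Qed.
Let q_gt0 : (0 < q)%N. Proof. by move: N_gt0; rewrite -{1}qG muln_gt0 => /andP[]. Qed.

Let qN : (Posz q %| Posz N)%Z.
Proof. by rewrite dvdzE /=; apply/dvdnP; exists (gcdn N (6 * h)); rewrite mulnC qG. Qed.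

Let N6 : (Posz N %| 6 * H * Posz q)%Z.
Proof.
rewrite -!PoszM dvdzE /= -{1}qG mulnC dvdn_mul //; exact: dvdn_gcdr.
Qed.

Let q72 : (Posz q %| 72 * H ^+ 2)%Z.
Proof.
rewrite -PoszX -PoszM dvdzE /= -(@dvdn_pmul2r (gcdn N (6 * h))) // qG.
rewrite muln_gcdr dvdn_gcd dvdn_mull //=.
have -> : (72 * h ^ 2 * (6 * h) = 144 * h ^ 3 * 3)%N by ring.
exact: dvdn_mulr.
Qed.

Let N144 : (Posz N %| 144 * H ^+ 3)%Z.
Proof. by rewrite -PoszX -PoszM dvdzE. Qed.

Let secK : cancel sec pi.
Proof. by case=> [i j]; rewrite /pi /= addrK !zresK. Qed.

Let piP v w : pi v = pi w <->
  (Posz N %| (v.1 - v.2) - (w.1 - w.2))%Z /\ (Posz q %| v.2 - w.2)%Z.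
Proof.
split=> [[/(zres_eq _ _ N_gt0) ? /(zres_eq _ _ q_gt0) ?] //|].
by case=> *; rewrite /pi; congr (_, _); apply/zres_eq.
Qed.

Let piI v w : (Posz N %| v.1 - w.1)%Z -> (Posz N %| v.2 - w.2)%Z -> pi v = pi w.
Proof.
move=> d1 d2; apply/piP; split; last exact: dvdz_trans qN d2.
by apply: (dvdz_lin (k1 := 1) (k2 := - 1) d1 d2); ring.
Qed.

Let fx (v : V) : V := (v.1 - 1, v.2).
Let fy (v : V) : V := (tgeom H v.1, texp H v.1 * (v.2 - 1)).
Let fc (v : V) : V := (A * v.1, B * v.2).
Let flow (j : int) (v : V) : V := (flowA H j v.1, flowP H j v.1 * v.2 - flowS H j v.1).

Let AB : (Posz N %| A * B - 1)%Z.
Proof. by apply: (dvdz_lin (k1 := 12) (k2 := 0) N144 (dvdz0 _)); ring. Qed.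

Let flow0 v : flow 0 v = v.
Proof.
case: v => u w; rewrite /flow /flowA /flowP /flowS; congr (_, _); rewrite /=; ring.
Qed.

Let flow_step j v : pi (fy (flow j v)) = pi (flow (j + 1) v).
Proof.
have [K1 E1] := flowA_step H j v.1; have [K2 E2] := flowP_step H j v.1.
have [K3 E3] := flowS_step H j v.1.
apply: piI => /=; first by rewrite E1 dvdz_mulr.
apply: (dvdz_lin (k1 := K2 * v.2 - K3) (k2 := 0) N144 (dvdz0 _)).
transitivity (144 * H ^+ 3 * K2 * v.2 - 144 * H ^+ 3 * K3); last by ring.
by rewrite -E2 -E3; ring.
Qed.

Let piD v w : pi v = pi w -> exists k l : int,
  v = (w.1 + (k * Posz q + l * Posz N), w.2 + k * Posz q).
Proof.
case/piP=> /dvdzP[l lE] /dvdzP[k kE]; exists k, l.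
rewrite -kE -lE; case: v {lE kE} => u1 u2 /=; congr (_, _); ring.
Qed.

Let fc_pi v w : pi v = pi w -> pi (fc v) = pi (fc w).
Proof.
case/piD=> k [l ->]; case: w => u w /=; apply/piP; split=> /=.
  by apply: (dvdz_lin (k1 := A * l) (k2 := k * (4 - 24 * H)) (dvdzz _) N6); ring.
by apply: (dvdz_lin (k1 := B * k) (k2 := 0) (dvdzz _) (dvdz0 _)); ring.
Qed.

Let fy_pi v w : pi v = pi w -> pi (fy v) = pi (fy w).
Proof.
case/piD=> k [l ->]; case: w => u w /=.
pose D := k * Posz q + l * Posz N.
pose S := - (1 - 12 * H) * (2 * u + D - 1)
  + 4 * H * (3 * u ^+ 2 + 3 * u * D + D ^+ 2 - 6 * u - 3 * D + 2).
pose M := (2 + 12 * H * (2 * u + D - 1)) * (w + k * Posz q - 1).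
apply/piP; split => /=.
  apply: (dvdz_lin (k1 := l * (1 + 6 * H * S - 6 * H * M))
    (k2 := k * (S - M - (2 * u + 12 * H * (u * (u - 1))))) (dvdzz _) N6).
  rewrite /M /S /D /tgeom /texp; ring.
apply: (dvdz_lin (k1 := k * (texp H u + 6 * H * M)) (k2 := 6 * H * l * M) (dvdzz _) qN).
rewrite /texp /M /D; ring.
Qed.

Lemma truncated_model : exists (T : finType) (x y : {perm T}),
  [/\ wamsley (1 + 12 * h) 1 x y [~ x, y]%g, (x ^+ N)%g = 1%g, (y ^+ N)%g = 1%g
    & (x ^+ (144 * h ^ 2))%g <> 1%g].
Proof.
have [x xE] : exists x : {perm T}, forall v, x (pi v) = pi (fx v).
  apply: (perm_of_map secK) => [v w /piP[d1 d2]|[u w]].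
    by apply/piP; split=> //=; apply: (dvdz_lin (k1 := 1) (k2 := 0) d1 (dvdz0 _)); ring.
  by exists (u + 1, w); rewrite /fx /= addrK.
have [y yE] : exists y : {perm T}, forall v, y (pi v) = pi (fy v).
  apply: (perm_of_map secK) => // w; exists (flow (- 1) w).
  by rewrite flow_step addNr flow0.
have [c cE] : exists c : {perm T}, forall v, c (pi v) = pi (fc v).
  apply: (perm_of_map secK) => // -[u w].
  exists (B * u, A * w); apply: piI => /=.
    by apply: (dvdz_lin (k1 := u) (k2 := 0) AB (dvdz0 _)); ring.
  by apply: (dvdz_lin (k1 := w) (k2 := 0) AB (dvdz0 _)); ring.
have xX k v : (x ^+ k)%g (pi v) = pi (v.1 - k%:Z, v.2).
  elim: k => [|k IH]; first by rewrite perm1 subr0; case: v.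
  by rewrite expgSr permM IH xE /fx /= -addrA -opprD -[1]/(Posz 1) -PoszD addn1.
have yX k v : (y ^+ k)%g (pi v) = pi (flow k%:Z v).
  elim: k => [|k IH]; first by rewrite perm1 flow0.
  by rewrite expgSr permM IH yE flow_step intS addrC.
have cyx : (c = [~ x, y])%g.
  apply: (mulgI (y * x)%g); rewrite -commgC.
  apply: (eq_perm_pi secK) => v; rewrite !permM yE xE xE yE cE; apply: piI => /=; rewrite /tgeom /texp.
    by apply: (dvdz_lin (k1 := 2 * (v.1 * (v.1 - 1)) * (v.1 + 1)) (k2 := 0) N144 (dvdz0 _)); ring.
  apply: (dvdz_lin (k1 := (12 * v.1 - 6 * (v.1 * (v.1 - 1)) + 72 * H * (v.1 * (v.1 - 1))) * (v.2 - 1))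
    (k2 := 0) N144 (dvdz0 _)); ring.
exists T, x, y; rewrite -cyx; split.
- split; last by rewrite expg1.
    apply: (mulgI c); rewrite conjgE mulKVg.
    apply: (eq_perm_pi secK) => v; rewrite !permM xE cE cE xX /fx /fc /=.
    congr (pi (_, _)); rewrite PoszD PoszM; ring.
  apply: (mulIg c); rewrite conjgE invgK !mulgA mulgKV.
  apply: (eq_perm_pi secK) => v; rewrite !permM cE yE yX cE.
  have [K1 E1] := flow_scaleA H v.1; have [K2 E2] := flow_scaleB H v.1 v.2.
  rewrite PoszD PoszM; apply/piP; split=> /=.
    apply: (dvdz_lin (k1 := K1 - K2) (k2 := 0) N144 (dvdz0 _)).
    transitivity ((- 72 * H ^+ 2 * v.1 + 144 * H ^+ 3 * K1)
      - (- 72 * H ^+ 2 * v.1 + 144 * H ^+ 3 * K2)); last by ring.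
    by rewrite -E1 -E2; ring.
  by rewrite E2; apply: (dvdz_lin (k1 := - v.1) (k2 := K2) q72 (dvdz_trans qN N144)); ring.
- apply: (eq_perm_pi secK) => v; rewrite xX perm1; apply: piI => /=; last by rewrite subrr.
  by rewrite addrAC subrr add0r rpredN dvdzz.
- apply: (eq_perm_pi secK) => v; rewrite yX perm1; apply: piI => /=.
    apply: (dvdz_lin (k1 := - (6 * H - 72 * H ^+ 2) * (v.1 * (v.1 - 1))
      + 24 * H ^+ 2 * (v.1 * (v.1 - 1)) * (v.1 - 2)
      + 18 * H ^+ 2 * (Posz N - 1) * (v.1 * (v.1 - 1)) * (2 * v.1 - 1)) (k2 := 0)
      (dvdzz _) (dvdz0 _)); rewrite /flowA; ring.
  apply: (dvdz_lin (k1 := (12 * H * v.1 - 36 * H ^+ 2 * (v.1 * (v.1 - 1)) * (Posz N - 1)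
      + 72 * H ^+ 2 * v.1 ^+ 2 * (Posz N - 1) + 72 * H ^+ 2 * (v.1 * (v.1 - 1))) * v.2
      - (1 + 6 * H * v.1 * (Posz N - 1) + 12 * H * v.1
      + 24 * H ^+ 2 * v.1 * (Posz N - 1) * (Posz N + 1)
      + 36 * H ^+ 2 * (Posz N - 1) * (v.1 * (v.1 - 1)) + 72 * H ^+ 2 * (v.1 * (v.1 - 1))))
      (k2 := 0) (dvdzz _) (dvdz0 _)); rewrite /flowP /flowS; ring.
move/permP/(_ (pi (0, 0))); rewrite xX perm1 => /piP[].
rewrite [X in (_ %| X)%Z](_ : _ = - Posz (144 * h ^ 2)%N); last by rewrite /fst /snd; ring.
by rewrite rpredN dvdzE !absz_nat (negbTE Nh2).
Qed.

End TruncatedModel.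

Local Close Scope group_scope.

(** Writing n = d k and 12 = d w with k and w coprime, h is chosen congruent to
    k / w modulo N, and N is k^3 times the part of 144 supported on the primes
    of k. *)
Lemma truncated_modulus (n : int) : n <> 0%R -> ~~ (n %| 12)%Z -> exists h N : nat,
  [/\ 0 < N, N %| 144 * h ^ 3, ~~ (N %| 144 * h ^ 2)
    & (Posz N %| (n - Posz (12 * h)%N)%R)%Z].
Proof.
move=> n0 n12; set m := `|n|%N.
have m0 : 0 < m by rewrite absz_gt0; apply/eqP.
pose d := gcdn m 12; have d0 : 0 < d by rewrite gcdn_gt0 m0.
have [k kE] : exists k, m = k * d by apply/dvdnP/dvdn_gcdl.
have [w wE] : exists w, 12 = w * d by apply/dvdnP/dvdn_gcdr.
have co_kw : coprime k w.
  by rewrite /coprime -(eqn_pmul2r d0) mul1n muln_gcdl -kE -wE.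
have k1 : 1 < k.
  rewrite ltn_neqAle eq_sym lt0n; apply/andP; split; last first.
    by apply: contraTneq m0 => k0; rewrite kE k0.
  apply: contra n12 => /eqP k1; rewrite dvdzE -/m kE k1 mul1n; exact: dvdn_gcdr.
have k0 : 0 < k := ltnW k1.
pose N := (144`_\pi(k) * k ^ 3)%N.
have N0 : 0 < N by rewrite muln_gt0 part_gt0 expn_gt0 k0.
have w0 : 0 < w by case: w wE {co_kw}.
have co_Nw : coprime N w.
  rewrite coprimeMl coprimeXl // andbT.
  by apply: (pnat_coprime (part_pnat _ _)); rewrite -coprime_pi'.
have [u uE] : exists u : int, (Posz N %| (Posz w * u - 1)%R)%Z.
  have [u' [u E]] := Bezoutz N w; exists u.
  have gNw : gcdz N w = 1%R by rewrite /gcdz !absz_nat (eqP co_Nw).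
  rewrite gNw in E; apply: (dvdz_lin (k1 := (- u')%R) (k2 := 0%R) (dvdzz _) (dvdz0 _)).
  by rewrite -E; ring.
pose e : int := (sgz n * Posz k)%R.
pose h := `|(u * e %% Posz N)%Z|%N.
have hE : (Posz N %| (Posz h - u * e)%R)%Z.
  by rewrite gez0_abs ?modz_ge0 ?eqz_nat -?lt0n // -eqz_mod_dvd modz_mod.
have hw : (Posz N %| (Posz w * Posz h - e)%R)%Z.
  by apply: (dvdz_lin (k1 := Posz w) (k2 := e) hE uE); ring.
have nE : n = (e * Posz d)%R.
  by rewrite /e -mulrA -PoszM -kE /m -numEsg.
have e2 : (e ^+ 2 = Posz k ^+ 2)%R.
  by rewrite /e exprMn; case: sgzP n0 => // *; rewrite ?sqrrN expr1n mul1r.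
exists h, N; split=> //.
- have co3 : coprime N (w ^ 3) by rewrite coprimeXr.
  rewrite -(Gauss_dvdl _ co3); have -> : 144 * h ^ 3 * w ^ 3 = 144 * (w * h) ^ 3 by ring.
  suff : (Posz N %| (Posz 144 * (Posz w * Posz h) ^+ 3)%R)%Z.
    by rewrite -PoszM -PoszX -PoszM dvdzE.
  have Nk : (Posz N %| (Posz 144 * Posz k ^+ 3)%R)%Z.
    rewrite -PoszX -PoszM dvdzE /= /N -[X in (_ %| X * _)%N](partnC \pi(k) (isT : 0 < 144)).
    by rewrite -mulnA dvdn_pmul2l ?part_gt0 // dvdn_mull.
  apply: (dvdz_lin (k1 := (Posz 144 * ((Posz w * Posz h) ^+ 2 + Posz w * Posz h * e + e ^+ 2))%R)
    (k2 := sgz n) hw Nk).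
  have -> : (Posz k ^+ 3 = e ^+ 2 * Posz k)%R by rewrite e2; ring.
  by rewrite /e; ring.
- apply/negP => Nh; have {}Nh : N %| 144 * k ^ 2.
    suff : (Posz N %| (Posz 144 * e ^+ 2)%R)%Z.
      by rewrite e2 -PoszX -PoszM dvdzE.
    have Nh' : (Posz N %| (Posz 144 * Posz h ^+ 2)%R)%Z.
      by rewrite -PoszX -PoszM dvdzE.
    apply: (dvdz_lin (k1 := (- Posz 144 * (Posz w * Posz h + e))%R)
      (k2 := (Posz w ^+ 2)%R) hw Nh'); ring.
  move: Nh; rewrite /N (expnS k 2) mulnA dvdn_pmul2r ?expn_gt0 ?k0 //.
  rewrite -[X in (_ %| X)%N](partnC \pi(k) (isT : 0 < 144)) dvdn_pmul2l ?part_gt0 //.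
  move=> kd; have : coprime k k.
    apply: coprime_dvdr kd _; rewrite coprime_pi' ?part_gt0 //; exact: part_pnat.
  by rewrite /coprime gcdnn; move: k1; case: (k) => [|[]].
rewrite wE nE; apply: (dvdz_lin (k1 := (- Posz d)%R) (k2 := 0%R) hw (dvdz0 _)).
rewrite !PoszM; ring.
Qed.

(** * Tables for the sporadic cases *)

Module Table.

Import BinNat Nnat.

(** The points are the classes of triples (a, b, c) modulo the lattice generated
    by (n, 0, 0), (q, q, 0) and (sg * D, 0, D); such a class is represented by
    (a - b - sg * c mod n, b mod q, c mod D). The residue al is alpha modulo n
    and be is its inverse. *)
Section TableModel.

Variables (n q D sg al be : N) (g : nat).

Local Notation V := (N * N * N)%type.

Let n1 := N.to_nat n.
Let q1 := N.to_nat q.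
Let D1 := N.to_nat D.
Let mu := N.modulo (iter g (N.mul al) 1%num) n.
Let nu := N.modulo (iter g (N.mul be) 1%num) n.

(* m1 stands for -1: subtractions are avoided *)
Let m1 : N := N.pred n.

Definition enc (a b c : N) : V :=
  (N.modulo (N.add a (N.mul m1 (N.add b (N.mul sg c)))) n, N.modulo b q, N.modulo c D).

Definition lift_fst (v : V) : N := N.modulo (N.add v.1.1 (N.add v.1.2 (N.mul sg v.2))) n.

Definition tab (f : N -> N) (x0 : N) : seq N := traject f x0 n1.

(** Entry i is the sum of the first i powers of nu, the inverse of mu. *)
Definition geom_tab : seq N := tab (fun r => N.modulo (N.succ (N.mul r nu)) n) N0.
Definition pow_tab (m : N) : seq N := tab (fun r => N.modulo (N.mul r m) n) 1%num.

(** The primed maps are the inverses of tx, ty and tz. *)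
Definition tx (v : V) : V := enc (N.add (lift_fst v) m1) v.1.2 v.2.
Definition tx' (v : V) : V := enc (N.succ (lift_fst v)) v.1.2 v.2.
Definition tz (v : V) : V :=
  enc (N.mul al (lift_fst v)) (N.mul be v.1.2) (N.add v.2 m1).
Definition tz' (v : V) : V :=
  enc (N.mul be (lift_fst v)) (N.mul al v.1.2) (N.succ v.2).
Definition ty (G P : seq N) (v : V) : V :=
  let a := lift_fst v in let i := N.to_nat a in
  enc (nth N0 G i) (N.mul (nth N0 P i) (N.add v.1.2 m1))
    (N.add v.2 (N.mul (N.of_nat g) a)).
Definition ty' (G P' : seq N) (v : V) : V :=
  let i := index (lift_fst v) G in
  enc (N.of_nat i) (N.succ (N.mul (nth N0 P' i) v.1.2))
    (N.add v.2 (N.mul m1 (N.of_nat (g * i)))).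

Definition inbox (v : V) : bool :=
  [&& N.to_nat v.1.1 < n1, N.to_nat v.1.2 < q1 & N.to_nat v.2 < D1].

Definition box : seq V :=
  [seq (u, N.of_nat k) | u <- [seq (N.of_nat i, N.of_nat j) | i <- iota 0 n1, j <- iota 0 q1],
     k <- iota 0 D1].

Definition inverse_at (f f' : V -> V) (v : V) : bool := inbox (f v) && (f' (f v) == v).

(** The relation f h = h f^alpha between permutations acting on the right; a
    negative power is moved to the other side. *)
Definition rel_pow (alpha : int) (f h : V -> V) (v : V) : bool :=
  match alpha with
  | Posz k => h (f v) == iter k f (h v)
  | Negz k => iter k.+1 f (h (f v)) == h v
  end.

(** The relation h f = f^alpha h. *)
Definition rel_pow' (alpha : int) (f h : V -> V) (v : V) : bool :=
  match alpha with
  | Posz k => f (h v) == h (iter k f v)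
  | Negz k => f (h (iter k.+1 f v)) == h v
  end.

Definition table_check (alpha : int) : bool :=
  let G := geom_tab in let P := pow_tab mu in let P' := pow_tab nu in
  let y := ty G P in
  all (fun v => [&& inverse_at tx tx' v, inverse_at y (ty' G P') v, inverse_at tz tz' v,
     rel_pow alpha tx tz v, rel_pow' alpha y tz v
     & y (tx v) == iter g tz (tx (y v))]) box &&
  (iter g tz (iter `|(alpha - 1)%R| tx (N0, N0, N0))
     != iter `|(alpha - 1)%R| tx (iter g tz (N0, N0, N0))).

Local Open Scope group_scope.

Let T : finType := 'I_n1.-1.+1 * 'I_q1.-1.+1 * 'I_D1.-1.+1 : Type.
Let pi (v : V) : T :=
  (inord (N.to_nat v.1.1), inord (N.to_nat v.1.2), inord (N.to_nat v.2)).
Let sec (t : T) : V :=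
  (N.of_nat (val t.1.1), N.of_nat (val t.1.2), N.of_nat (val t.2)).

Hypotheses (n1_gt0 : 0 < n1) (q1_gt0 : 0 < q1) (D1_gt0 : 0 < D1).

Let secK : cancel sec pi.
Proof.
case=> [[i j] k]; rewrite /pi /= !Nat2N.id.
by congr (_, _, _); apply: val_inj; rewrite /= inordK.
Qed.

Let sec_box t : inbox (sec t).
Proof.
case: t => [[i j] k]; rewrite /inbox /= !Nat2N.id.
have lt m (o : 'I_m.-1.+1) : 0 < m -> val o < m by move=> m0; have := ltn_ord o; rewrite [X in _ < X]prednK.
by rewrite !lt.
Qed.

Let piK v : inbox v -> sec (pi v) = v.
Proof.
case: v => [[a b] c] /and3P[/= la lb lc]; rewrite /sec /pi /=.
by rewrite !inordK ?prednK // !N2Nat.id.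
Qed.

Let mem_box v : inbox v -> v \in box.
Proof.
case: v => [[a b] c] /and3P[/= la lb lc]; rewrite -(N2Nat.id a) -(N2Nat.id b) -(N2Nat.id c).
apply: (allpairs_f (fun u k => (u, N.of_nat k))); last by rewrite mem_iota.
by apply: (allpairs_f (fun i j => (N.of_nat i, N.of_nat j))); rewrite mem_iota.
Qed.

Let perm_of_table f f' : all (inverse_at f f') box ->
  exists p : {perm T}, forall v, inbox v -> inbox (f v) /\ p (pi v) = pi (f v).
Proof.
move=> /allP ff'; pose F t := pi (f (sec t)).
have gp v : inbox v -> inbox (f v) /\ f' (f v) = v.
  by move=> /mem_box/ff'/andP[? /eqP].
have Finj : injective F.
  move=> t u /(congr1 sec); have [b1 E1] := gp _ (sec_box t).
  have [b2 E2] := gp _ (sec_box u); rewrite !piK // => /(congr1 f').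
  by rewrite E1 E2 => /(can_inj secK).
exists (perm Finj) => v bv; have [bf _] := gp _ bv.
by rewrite permE /F piK.
Qed.

Let iter_pi (p : {perm T}) f k v :
    (forall v, inbox v -> inbox (f v) /\ p (pi v) = pi (f v)) -> inbox v ->
  inbox (iter k f v) /\ (p ^+ k) (pi v) = pi (iter k f v).
Proof.
move=> pE bv; elim: k => [|k [bk IH]]; first by rewrite perm1.
by rewrite expgSr permM IH /=; apply: pE.
Qed.

Let eq_perm_box (p p' : {perm T}) :
  (forall v, inbox v -> p (pi v) = p' (pi v)) -> p = p'.
Proof. by move=> E; apply/permP=> t; rewrite -(secK t); apply: E. Qed.

Lemma table_model (alpha : int) : table_check alpha ->
  exists (T : finType) (x y z : {perm T}),
  [/\ x ^ z = expgz x alpha, y ^ z^-1 = expgz y alpha, z ^+ g = [~ x, y]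
     & ~ commute (x ^+ `|(alpha - 1)%R|) (z ^+ g)].
Proof.
case/andP=> /allP chk wit.
set f_y := ty geom_tab (pow_tab mu) in chk.
have chkP v : inbox v -> _ := fun bv => chk v (mem_box bv).
have [x xE] : exists p : {perm T}, forall v, inbox v -> inbox (tx v) /\ p (pi v) = pi (tx v).
  by apply: (@perm_of_table _ tx'); apply/allP=> v /chk /and5P[].
have [y yE] : exists p : {perm T}, forall v, inbox v -> inbox (f_y v) /\ p (pi v) = pi (f_y v).
  by apply: (@perm_of_table _ (ty' geom_tab (pow_tab nu))); apply/allP=> v /chk /and5P[].
have [z zE] : exists p : {perm T}, forall v, inbox v -> inbox (tz v) /\ p (pi v) = pi (tz v).
  by apply: (@perm_of_table _ tz'); apply/allP=> v /chk /and5P[].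
exists T, x, y, z; split.
- case: alpha chk chkP {wit} => k chk chkP; apply: (mulgI z); rewrite conjgE mulKVg /=.
    apply: eq_perm_box => v bv; have [bx Ex] := xE _ bv; have [bxz Exz] := zE _ bx.
    have [bz Ez] := zE _ bv; have [_ Ezx] := iter_pi k xE bz.
    rewrite !permM Ex Exz Ez Ezx; congr pi; apply/eqP.
    by case/and5P: (chkP v bv) => _ _ _ /eqP ->.
  apply: (mulIg (x ^+ k.+1)); rewrite mulgKV.
  apply: eq_perm_box => v bv; have [bx Ex] := xE _ bv; have [bxz Exz] := zE _ bx.
  have [bz Ez] := zE _ bv; have [_ Exzx] := iter_pi k.+1 xE bxz.
  rewrite !permM Ex Exz Exzx Ez; congr pi; apply/eqP.
  by case/and5P: (chkP v bv).
- case: alpha chk chkP {wit} => k chk chkP; apply: (mulIg z).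
    rewrite conjgE invgK !mulgA mulgKV /=.
    apply: eq_perm_box => v bv; have [bz Ez] := zE _ bv; have [bzy Ezy] := yE _ bz.
    have [by_ Ey] := iter_pi k yE bv; have [_ Eyz] := zE _ by_.
    rewrite !permM Ez Ezy Ey Eyz; congr pi; apply/eqP.
    by case/and5P: (chkP v bv) => _ _ _ _ /andP[].
  apply: (mulgI (y ^+ k.+1)); rewrite conjgE invgK !mulgA mulgV mul1g mulgKV.
  apply: eq_perm_box => v bv; have [bz Ez] := zE _ bv.
  have [by_ Ey] := iter_pi k.+1 yE bv; have [byz Eyz] := zE _ by_.
  have [_ Eyzy] := yE _ byz; rewrite !permM Ey Eyz Eyzy Ez; congr pi; apply/eqP.
  by case/and5P: (chkP v bv) => _ _ _ _ /andP[].
- apply: (mulgI (y * x)); rewrite -commgC; apply: eq_perm_box => v bv.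
  have [bx Ex] := xE _ bv; have [by_ Ey] := yE _ bv; have [byx Eyx] := xE _ by_.
  have [bxy Exy] := yE _ bx; have [_ Ez] := iter_pi g zE byx.
  rewrite !permM Ex Exy Ey Eyx Ez; congr pi; apply/esym/eqP.
  by have := chkP v bv; case/and5P=> _ _ _ _ /andP[].
pose o : V := (N0, N0, N0); have bo : inbox o by rewrite /inbox /= n1_gt0 q1_gt0.
move=> cxz; case/negP: wit; apply/eqP.
have [bx Ex] := iter_pi `|(alpha - 1)%R| xE bo; have [bz Ez] := iter_pi g zE bo.
have [bxz Exz] := iter_pi g zE bx; have [bzx Ezx] := iter_pi `|(alpha - 1)%R| xE bz.
rewrite -(piK bxz) -(piK bzx) -Exz -Ezx -Ex -Ez -!permM.
by rewrite cxz.
Qed.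

End TableModel.

(** The first eight pairs are those with gamma = 1 and alpha - 1 a divisor of 12;
    in the last three pairs alpha^gamma - 1 divides (alpha - 1)^2. The pairs
    (0, 1), (2, 1), (-1, 1) and (3, 1) are absent. *)
Definition cases : seq (int * nat) :=
  [:: (Posz 4, 1); (Negz 1, 1); (Posz 7, 1); (Negz 4, 1); (Posz 13, 1); (Negz 10, 1);
      (Posz 5, 1); (Negz 2, 1); (Negz 2, 2); (Negz 1, 2); (Negz 1, 3)].

Local Open Scope group_scope.

Lemma table_model_cases (alpha : int) (g : nat) :
    (alpha, g) \in cases ->
  exists (T : finType) (x y z : {perm T}),
  [/\ x ^ z = expgz x alpha, y ^ z^-1 = expgz y alpha, z ^+ g = [~ x, y]
     & ~ commute (x ^+ `|(alpha - 1)%R|) (z ^+ g)].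
Proof.
have M n q D sg al be (c : int) k :
    [&& 0 < N.to_nat n, 0 < N.to_nat q, 0 < N.to_nat D & table_check n q D sg al be k c] ->
  exists (T : finType) (x y z : {perm T}),
  [/\ x ^ z = expgz x c, y ^ z^-1 = expgz y c, z ^+ k = [~ x, y]
     & ~ commute (x ^+ `|(c - 1)%R|) (z ^+ k)].
  by case/and4P=> n0 q0 D0; apply: table_model.
rewrite !inE => /or4P[||| /or4P[||| /or4P[||| /orP[|]]]] /eqP[-> ->].
- by apply: (M 27 9 1 0 4 7)%num; vm_compute.
- by apply: (M 27 9 1 0 25 13)%num; vm_compute.
- by apply: (M 27 9 1 0 7 4)%num; vm_compute.
- by apply: (M 27 9 1 0 22 16)%num; vm_compute.
- by apply: (M 27 9 1 0 13 25)%num; vm_compute.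
- by apply: (M 27 9 1 0 16 22)%num; vm_compute.
- by apply: (M 32 8 4 2 5 13)%num; vm_compute.
- by apply: (M 32 8 4 2 29 21)%num; vm_compute.
- by apply: (M 64 16 1 0 61 21)%num; vm_compute.
- by apply: (M 27 9 1 0 25 13)%num; vm_compute.
- by apply: (M 81 27 1 0 79 40)%num; vm_compute.
Qed.

End Table.

Local Open Scope group_scope.

(** * The derived length *)

Lemma modulus_lift (alpha : int) (K : nat) : 0 < K ->
  exists2 a : nat, 1 < a & (Posz K %| (Posz a - alpha)%R)%Z.
Proof.
move=> K0; exists (`|(alpha %% K)%Z| + 2 * K)%N; first by lia.
rewrite PoszD gez0_abs ?modz_ge0 ?eqz_nat -?lt0n //.
move: (divz_eq alpha K); move: (alpha %% K)%Z (alpha %/ K)%Z => r d ->.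
apply: (dvdz_lin (k1 := (2 - d)%R) (k2 := 0%R) (dvdzz _) (dvdz0 _)).
by rewrite PoszM; ring.
Qed.

Section Presentation.

Variables (gT : finGroupType) (W : {group gT}) (alpha : int) (g : nat).
Hypothesis isoW : W \isog Grp (X : Y : Z :
     X ^ Z = X ^~ alpha, Z * Y * Z^-1 = Y ^~ alpha, Z ^+ g = [~ X, Y]).

Lemma presented_der_neq1 (rT : finGroupType) (x y z : rT) k :
    x ^ z = expgz x alpha -> y ^ z^-1 = expgz y alpha -> z ^+ g = [~ x, y] ->
  <<[set x; y; z]>>^`(k) != 1 -> W^`(k) != 1.
Proof.
move=> xz yz zg; apply: contraNneq => W1; apply/eqP.
apply: (@homg_der_trivial _ _ W <<[set x; y; z]>>%G) W1.
by rewrite isoW; apply/wamsley_homGrp; exists x, y, z.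
Qed.

(** The exponent alpha only matters modulo a common exponent of x and y. *)
Lemma wamsley_der_neq1 (rT : finGroupType) (x y z : rT) (a L : nat) k :
    wamsley a g x y z -> x ^+ L = 1 -> y ^+ L = 1 ->
    (Posz L %| (Posz a - alpha)%R)%Z ->
  <<[set x; y; z]>>^`(k) != 1 -> W^`(k) != 1.
Proof.
case=> xz yz zg xL yL La; apply: presented_der_neq1 => //.
  by rewrite xz (expgz_mod xL La).
by rewrite yz (expgz_mod yL La).
Qed.

Lemma presented_wamsley : exists x y z : gT,
  [/\ W :=: <<[set x; y; z]>>, x ^+ #|W| = 1, y ^+ #|W| = 1
    & forall a : nat, (Posz #|W| %| (Posz a - alpha)%R)%Z -> wamsley a g x y z].
Proof.
have := isoGrp_hom isoW => /wamsley_homGrp[x [y [z [WE xz yz zg]]]].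
have cW u : u \in [set x; y; z] -> u ^+ #|W| = 1.
  by move=> Su; apply/eqP; rewrite -order_dvdn order_dvdG // WE mem_gen.
have [cx cy] : x ^+ #|W| = 1 /\ y ^+ #|W| = 1.
  by split; apply: cW; rewrite !inE eqxx ?orbT.
exists x, y, z; split=> // a La; split=> //.
  by rewrite xz (expgz_mod cx La).
by rewrite yz (expgz_mod cy La).
Qed.

Lemma derived_length_le k : W^`(3) = 1 -> (derived_length W <= k) = (W^`(k) == 1).
Proof.
move=> W3; rewrite -derived_lengthP //; apply/derivedP; exists 3.
by rewrite W3.
Qed.

Lemma presented_der3 : 0 < g -> W^`(3) = 1.
Proof.
move=> g0; have [x [y [z [WE _ _ Wr]]]] := presented_wamsley.
have [a a1 La] := modulus_lift alpha (cardG_gt0 W).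
by rewrite WE; apply: (wamsley_der3 a1 g0); apply: Wr.
Qed.

Lemma presented_der2_special :
    (alpha == - 1)%R && odd g || (alpha == 3)%R && (g == 1)%N -> W^`(2) = 1.
Proof.
have [x [y [z [WE xW yW Wr]]]] := presented_wamsley.
have K0 := cardG_gt0 W; rewrite WE => /orP[] /andP[/eqP aE gE].
  have {}Wr : wamsley (12 * #|W|).-1 g x y z.
    apply: Wr; rewrite aE opprK -[1%R]/(Posz 1) -PoszD addn1 prednK ?muln_gt0 //.
    by rewrite dvdzE /= dvdn_mull.
  apply: (wamsley_der2 _ Wr); first by lia.
    exact: wamsley_square_commute xW Wr.
  exact: wamsley_square_commute yW (wamsley_sym Wr).
have {}Wr : wamsley 3 1 x y z.
  by rewrite (eqP gE) in Wr; apply: Wr; rewrite aE; exact: dvdz0.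
apply: (wamsley_der2 _ Wr) => //; first exact: (wamsley_central_power _ _ Wr).
exact: (wamsley_central_power _ _ (wamsley_sym Wr)).
Qed.

Lemma heisenberg_der (M : nat) : 0 < g -> 1 < M -> (Posz M %| (alpha ^+ g - 1)%R)%Z ->
  W^`(1) != 1 /\ (~~ (Posz M %| ((alpha - 1) ^+ 2)%R)%Z -> W^`(2) != 1).
Proof.
move=> g0 M1 Mag; have M0 := ltnW M1.
have [a a1 Ma] := modulus_lift alpha M0.
have ag : (a ^ g = 1 %[mod M])%N.
  apply/eqP; rewrite -eqz_nat -!modz_nat eqz_mod_dvd PoszX.
  have Mag' : (Posz M %| (Posz a ^+ g - alpha ^+ g)%R)%Z by rewrite subrXX dvdz_mulr.
  by apply: (dvdz_lin (k1 := 1%R) (k2 := 1%R) Mag' Mag); ring.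
have [T [x [y [z [Wr xM yM [cx cy] ck]]]]] := heisenberg_model g0 M0 ag.
split=> [|Ms]; apply: (wamsley_der_neq1 Wr xM yM Ma).
  apply/eqP => W1; have : [~ x, y] ^+ 1 = 1.
    rewrite expg1; apply/set1gP; rewrite -[1%g]W1 mem_commg // mem_gen //.
      by rewrite !inE eqxx.
    by rewrite !inE eqxx orbT.
  by move/ck; rewrite dvdn1 => /eqP M1'; rewrite M1' in M1.
apply: (wamsley_der2_neq1 (ltnW a1) Wr); apply/orP; right.
rewrite commXXg //; apply: contra Ms => /eqP/ck.
have aE : Posz a.-1 = (Posz a - 1)%R by rewrite -subn1 -subzn // ltnW.
rewrite -[(M %| _)%N]/((Posz M %| Posz (a.-1 * a.-1)%N)%Z) PoszM aE => Ma2.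
by apply: (dvdz_lin (k1 := 1%R) (k2 := (- (Posz a + alpha - 2))%R) Ma2 Ma); ring.
Qed.

Lemma truncated_der2 : g = 1%N -> alpha <> 1%R -> ~~ ((alpha - 1)%R %| 12)%Z -> W^`(2) != 1.
Proof.
move=> g1 a1 a12; have n0 : (alpha - 1)%R <> 0%R by move/eqP; rewrite subr_eq0 => /eqP.
have [h [N [N0 Nh3 Nh2 Na]]] := truncated_modulus n0 a12.
have [T [x [y [Wr xN yN xh]]]] := truncated_model N0 Nh3 Nh2.
have Wr' : wamsley (1 + 12 * h) g x y [~ x, y] by rewrite g1.
apply: (wamsley_der_neq1 Wr' xN yN).
  apply: (dvdz_lin (k1 := (- 1)%R) (k2 := 0%R) Na (dvdz0 _)).
  by rewrite PoszD; ring.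
apply: (wamsley_der2_neq1 _ Wr') => //; apply/orP; left; apply/eqP.
rewrite g1 expn1 add1n /= => E; case: xh; rewrite -E; congr (_ ^+ _); ring.
Qed.

(** W' contains x ^+ |alpha - 1|, up to inversion equal to [x, z], and z ^+ g. *)
Lemma table_der2 : (alpha, g) \in Table.cases -> W^`(2) != 1.
Proof.
case/Table.table_model_cases=> T [x [y [z [xz yz zg ncom]]]].
apply: (presented_der_neq1 xz yz zg); apply/eqP => W2; case: ncom.
pose V := <<[set x; y; z]>>%G.
have [Vx Vy Vz] : [/\ x \in V, y \in V & z \in V].
  by split; apply: mem_gen; rewrite !inE eqxx ?orbT.
have V1c : z ^+ g \in V^`(1) by rewrite zg mem_commg.
have V1x : x ^+ `|(alpha - 1)%R| \in V^`(1).
  have : [~ x, z] \in V^`(1) by rewrite mem_commg.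
  rewrite commgEl xz; rewrite /expgz; case: (alpha) => [[|k]|k].
  - by rewrite mulg1 groupV.
  - have -> : absz (Posz k.+1 - 1)%R = k by lia.
    by rewrite expgS mulKg.
  have -> : absz (Negz k - 1)%R = k.+2 by lia.
  by rewrite -invMg groupV -expgSr.
apply/commgP/eqP/set1gP; rewrite -[1%g]W2; exact: mem_commg.
Qed.

End Presentation.

(** For |alpha| > 1 and g > 3 the divisor exceeds the square in absolute value;
    for g = 2 and g = 3 the common factor alpha - 1 cancels. *)
Lemma dvdz_expn_pred_cases (alpha : int) (g : nat) :
    0 < g -> alpha != 0%R -> (alpha ^+ g != 1)%R ->
    ((alpha ^+ g - 1)%R %| ((alpha - 1) ^+ 2)%R)%Z ->
  [|| g == 1%N, alpha == (- 1)%R |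
      (alpha, g) \in ([:: (Negz 2, 2); (Negz 1, 2); (Negz 1, 3)] : seq (int * nat))%N].
Proof.
move=> g0 a0 ag; have a1 : alpha != 1%R by apply: contraNneq ag => ->; rewrite expr1n.
have [->|am1] := eqVneq alpha (- 1)%R; first by rewrite orbT.
pose t := absz alpha.
have t2 : 1 < t by rewrite /t; move: a0 a1 am1; lia.
have [a1' e1] : (alpha - 1 != 0)%R /\ (alpha + 1 != 0)%R by split; move: a1 am1; lia.
case: g g0 ag => // -[|[|[|g]]] _ ag dv //=.
- have d2 : ((alpha + 1)%R %| 2)%Z.
    have : (((alpha - 1) * (alpha + 1))%R %| ((alpha - 1) * (alpha - 1))%R)%Z.
      by move: dv; rewrite (_ : alpha ^+ 2 - 1 = (alpha - 1) * (alpha + 1))%R //; ring.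
    rewrite dvdz_mul2l // => d1.
    by apply: (dvdz_lin (k1 := (- 1)%R) (k2 := 1%R) d1 (dvdzz _)); ring.
  have le2 : `|(alpha + 1)%R| <= 2 by apply: (@dvdn_leq _ 2).
  have [->|->] : (alpha = - 3)%R \/ (alpha = - 2)%R; [|by []|by []].
  by move: a0 a1 am1 le2; lia.
- have d3 : ((alpha ^+ 2 + alpha + 1)%R %| (alpha - 1)%R)%Z.
    rewrite -(@dvdz_mul2l (alpha - 1)%R) //.
    by move: dv; rewrite (_ : alpha ^+ 3 - 1 = (alpha - 1) * (alpha ^+ 2 + alpha + 1))%R //; ring.
  have := @dvdn_leq `|(alpha ^+ 2 + alpha + 1)%R| `|(alpha - 1)%R|.
  rewrite absz_gt0 a1' => /(_ isT d3) le3.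
  have -> : alpha = (- 2)%R; last by [].
  by move: le3 t2; rewrite /t; nia.
have : `|(alpha ^+ g.+4 - 1)%R| <= `|((alpha - 1) ^+ 2)%R|.
  by apply: dvdn_leq dv; rewrite absz_gt0 expf_neq0.
have le1 : t ^ g.+4 <= `|(alpha ^+ g.+4 - 1)%R| + 1.
  by rewrite /t -abszX; lia.
have le2 : `|((alpha - 1) ^+ 2)%R| <= (t + 1) ^ 2.
  by rewrite abszX leq_exp2r // /t; lia.
have le3 : t ^ 4 <= t ^ g.+4 by rewrite leq_exp2l.
move=> le4; have : t ^ 4 <= (t + 1) ^ 2 + 1.
  by apply: leq_trans le3 (leq_trans le1 _); rewrite leq_add2r (leq_trans le4).
by move: t2; move: (t) => u; nia.
Qed.

Lemma presented_der2_neq1 (alpha : int) (g : nat) (gT : finGroupType) (W : {group gT}) :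
    0 < g -> alpha <> 0%R -> (alpha ^+ g)%R <> 1%R -> ~ (alpha = 2%R /\ g = 1%N) ->
    ~~ ((alpha == (- 1)%R) && odd g || (alpha == 3)%R && (g == 1)%N) ->
    W \isog Grp (X : Y : Z :
     X ^ Z = X ^~ alpha, Z * Y * Z^-1 = Y ^~ alpha, Z ^+ g = [~ X, Y]) ->
  W^`(2) != 1.
Proof.
move=> g0 a0 ag a21 nsp isoW.
have M0 : (alpha ^+ g - 1 != 0)%R by rewrite subr_eq0; apply/eqP.
pose M := absz (alpha ^+ g - 1)%R.
have dM (d : int) : (Posz M %| d)%Z = ((alpha ^+ g - 1)%R %| d)%Z by rewrite !dvdzE.
have [dv|ndv] := boolP ((alpha ^+ g - 1)%R %| ((alpha - 1) ^+ 2)%R)%Z; last first.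
  have M1 : 1 < M.
    rewrite ltn_neqAle absz_gt0 M0 andbT eq_sym; apply: contraNneq ndv => M1.
    by rewrite -dM M1 dvd1z.
  by have [_ ->] := heisenberg_der isoW g0 M1 (eq_ind_r is_true (dvdzz _) (dM _)); rewrite // dM.
have := dvdz_expn_pred_cases g0 (introN eqP a0) (introN eqP ag) dv.
have [gE|g1] /= := eqVneq g 1%N; last first.
  have [aE|_] /= := eqVneq alpha (- 1)%R.
    move: nsp ag; rewrite aE eqxx /= orbF => /negbTE og.
    by rewrite -signr_odd og.
  move=> cs; apply: (table_der2 isoW).
  by move: cs; rewrite !inE => /or3P[] ->; rewrite ?orbT.
move=> _; have a1 : alpha <> 1%R by move=> a1; case: ag; rewrite a1 expr1n.
have [d12|] := boolP ((alpha - 1)%R %| 12)%Z; last exact: (truncated_der2 isoW gE a1).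
apply: (table_der2 isoW); rewrite gE; rewrite gE in nsp a21.
have le12 : `|(alpha - 1)%R| <= 12 by apply: (@dvdn_leq _ 12).
move: d12; rewrite dvdzE /=.
have : (alpha - 1 = Posz `|(alpha - 1)%R|)%R \/ (alpha - 1 = - Posz `|(alpha - 1)%R|)%R by lia.
move: (absz (alpha - 1)) le12 => k le12 kE; move: le12.
case: k kE => [|[|[|[|[|[|[|[|[|[|[|[|[|k]]]]]]]]]]]]] //= kE _ _.
all: case: kE => /(canRL (subrK _)) aE; subst alpha.
all: first [done | by case: a0 | by case: a1 | by case: a21 | by case/negP: nsp].
Qed.

Local Close Scope group_scope.

Theorem theorem12p1 (alpha : int) (gamma : nat)
    (gamma_gt0 : (0 < gamma)%N)
    (alpha_gamma_neq1 : (alpha ^+ gamma)%R <> 1%R)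
    (alpha_neq0 : alpha <> 0%R)
    (alpha_gamma_neq21 : ~ (alpha = 2%R /\ gamma = 1%N))
    (gT : finGroupType) (W : {group gT}) :
  (W \isog Grp (X : Y : Z :
     X ^ Z = X ^~ alpha, Z * Y * Z^-1 = Y ^~ alpha, Z ^+ gamma = [~ X, Y]))%g ->
  derived_length W =
    if ((alpha == (-1)%R) && odd gamma) || ((alpha == 3%R) && (gamma == 1%N))
    then 2%N else 3%N.
Proof.
move=> isoW; have W3 := presented_der3 isoW gamma_gt0.
have dl k := derived_length_le k W3.
case: ifPn => [sp | nsp]; apply/eqP; rewrite eqn_leq dl ltnNge dl; last first.
  by rewrite W3 eqxx (presented_der2_neq1 gamma_gt0 alpha_neq0 _ _ nsp isoW).
rewrite (presented_der2_special isoW sp) eqxx.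
have [|-> //] := @heisenberg_der _ _ _ _ isoW 2 gamma_gt0 isT.
case/orP: sp => /andP[/eqP -> ]; last by move/eqP ->.
by move=> og; rewrite -signr_odd og.
Qed.
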